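(* Let $c\ge 7$ and $\alpha\ge 2$ be integers, and let $T$ be an $r$-regular $c$-partite tournament in which every partite set has cardinality $\alpha$. Then every arc of $T$ belongs to at least $c\alpha-\alpha-1$ cycles of pairwise distinct lengths. Moreover, the following hold for every arc $xy$ of $T$. (1) If $xy$ belongs to a $3$-cycle, then $xy$ belongs to a cycle of length $\ell$ for every $\ell\in\{3,4,\ldots,c\alpha-\alpha+1\}$. (2) If $xy$ belongs to no $3$-cycle, then $xy$ belongs to a cycle of length $\ell$ for every $\ell\in\{4,5,\ldots,c\alpha-\alpha+2\}$.
   Context: A $c$-partite tournament is an orientation of a complete $c$-partite graph (finite, with $c$ nonempty partite sets): between any two vertices in different partite sets there is exactly one arc, and there are no arcs within a partite set. A digraph is $r$-regular if $d^+(v)=d^-(v)=r$ for every vertex $v$; here necessarily $r=(c-1)\alpha/2$. Cycles are directed and simple; the length of a cycle is its number of arcs. *)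

(* Defs.v *)
From mathcomp Require Import all_boot.

Set Implicit Arguments.
Unset Strict Implicit.
Unset Printing Implicit Defensive.

(* A loopless digraph without parallel arcs is its arc relation e on a finite
   vertex type; P is the set of partite sets, which [partition] forces to be
   nonempty. *)
Definition multipartite_tournament (V : finType) (c : nat)
    (P : {set {set V}}) (e : rel V) : Prop :=
  [/\ partition P [set: V],
      #|P| = c,
      (forall u v, pblock P u = pblock P v -> ~~ e u v) &
      (forall u v, pblock P u <> pblock P v -> e u v (+) e v u)].

Definition outdeg (V : finType) (e : rel V) (v : V) : nat := #|[set w | e v w]|.
Definition indeg (V : finType) (e : rel V) (v : V) : nat := #|[set w | e w v]|.

Definition regular_digraph (V : finType) (e : rel V) (r : nat) : Prop :=
  forall v, outdeg e v = r /\ indeg e v = r.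

(* A directed simple cycle is represented by the sequence p of its vertices in
   cyclic order, so that its number of arcs is [size p]. *)
Definition arc_in_cycle (V : finType) (e : rel V) (x y : V) (p : seq V) : Prop :=
  [/\ ucycle e p, x \in p & next p x = y].

Definition arc_in_cycle_of_length (V : finType) (e : rel V) (x y : V)
    (l : nat) : Prop :=
  exists2 p : seq V, arc_in_cycle e x y p & size p = l.

Definition arc_in_cycles_of_distinct_lengths (V : finType) (e : rel V)
    (x y : V) (k : nat) : Prop :=
  exists s : seq (seq V),
    [/\ forall p, p \in s -> arc_in_cycle e x y p,
        uniq (map size s) & k <= size s].

(* Main.v *)
Require Import Defs.
From mathcomp Require Import all_boot.
From mathcomp Require Import zify.

Set Implicit Arguments.
Unset Strict Implicit.
Unset Printing Implicit Defensive.

(** Write [A] for the out-neighbours of [y] and [B] for the in-neighbours of [x];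
    both have [r] elements.  A cycle of length [d + 3] through the arc [xy] is the
    same thing as a path with [d + 1] vertices that starts in [A], ends in [B] and
    avoids [x] and [y].  Let [p] be a Hamiltonian cycle of the subdigraph induced by
    a set [H] avoiding [x] and [y].  Such a path can be read off [p] as soon as some
    vertex of [A] is followed, [d] steps later, by a vertex of [B].

    If [xy] lies on a triangle, then [A] and [B] meet, so there is an [H] with
    [2 * r - 1] vertices that contains both.  As [A] and [B] have together more than
    [#|H|] elements, counting settles every [d < #|H|] ([hits_by_counting]).  If [A]
    and [B] are disjoint, take for [H] their union, or their union minus one vertex
    of [B].  A failure for [d] means that [A] is invariant under the rotation of [p]
    by [d] steps, so that [#|H| / gcd (d, #|H|)] divides [#|A| = r]
    ([rotation_invariant_card]).  This is absurd for [#|H| = 2 * r - 1] and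
    [0 < d < #|H|], and also for [#|H| = 2 * r] and [d = 2 * r - 1].

    What remains is [near_regular_hamiltonian]: the digraph stays Hamiltonian when
    [alpha] or [alpha + 1] vertices are deleted.  Hall's theorem yields a cover of
    the remaining vertices by disjoint cycles ([cycle_cover_exists]); consider one
    with as few cycles as possible, so that no two or three of its cycles can be
    merged.  For two cycles [p1] and [p2] this forces nearly all arcs between them to
    go the same way ([dominance]): if [p1] dominates [p2], then every arc from [b] on
    [p2] back to [a] on [p1] is such that the successor of [b] and the predecessor
    of [a] lie in one partite set.  Hence there are at most as many back arcs as
    pairs of vertices, one on each cycle, from a common partite set.  Domination has
    no cyclic triples ([dominance_triangle_merges]), so some cycle dominates all
    others.  Comparing degrees on the smaller side of this cut ([cut_bound]) gives a
    contradiction, and this is where at least seven partite sets are needed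
    ([cut_bound_fails]).  Seven partite sets of size two with cycles of lengths five
    and six just escape the count; there every vertex on one side has a back arc,
    and two consecutive back arcs allow a merger ([no_consecutive_back_arcs]). *)

(** * Cyclic sequences and insertion of paths into cycles *)

Lemma next_split (T : eqType) (l r : seq T) a :
  uniq (l ++ a :: r) -> next (l ++ a :: r) a = head a (r ++ l).
Proof.
move=> Ulr; rewrite -(next_rot (size l)) // rot_size_cat cat_cons.
by case: (r ++ l) => [|b t] /=; rewrite ?eqxx.
Qed.

Lemma rot_uniq_next (T : eqType) (p : seq T) i q :
  uniq p -> rot i p = q -> [/\ uniq q, next q =1 next p, prev q =1 prev p & q =i p].
Proof.
move=> Up <-; split; first by rewrite rot_uniq.
- exact: next_rot.
- exact: prev_rot.
- exact: mem_rot.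
Qed.

Lemma rot_to_last (T : eqType) (p : seq T) x :
  x \in p -> exists i u, rot i p = rcons u x.
Proof.
case/rot_to => i u ri; exists (rot_add p i 1), u.
rewrite -rot_rot_add ri; exact: rot1_cons.
Qed.

Lemma prev_split (T : eqType) (l r : seq T) a :
  uniq (l ++ a :: r) -> prev (l ++ a :: r) a = last a (r ++ l).
Proof.
move=> U; have U' : uniq (rev (l ++ a :: r)) by rewrite rev_uniq.
rewrite -[l ++ _]revK (prev_rev U') rev_cat rev_cons cat_rcons next_split.
  by rewrite -rev_cat; case/lastP: (r ++ l) => // t b; rewrite rev_rcons last_rcons.
by rewrite -cat_rcons -rev_cons -rev_cat.
Qed.

Lemma cycle_sorted (T : Type) (R : rel T) p : cycle R p -> sorted R p.
Proof. by case: p => //= x p; rewrite rcons_path => /andP[]. Qed.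

(** Every element of a cyclic sequence is reached from [x] by repeated [next]. *)
Lemma next_ind (T : eqType) (P : T -> Prop) (p : seq T) x :
    uniq p -> x \in p -> P x -> {in p, forall a, P a -> P (next p a)} ->
  {in p, forall a, P a}.
Proof.
move=> Up xp Px stepP; case/rot_to: (xp) => i s ri.
have [Us Ns _ Ms] := rot_uniq_next Up ri.
suff pref s1 : forall s2, s = s1 ++ s2 -> P (last x s1).
  move=> a; rewrite -Ms inE => /orP[/eqP->//|].
  move=> a_s; case/splitPr: a_s pref => s1 s2 /(_ (rcons s1 a) s2).
  by rewrite cat_rcons last_rcons; apply.
elim/last_ind: s1 => [|s1 a IHs] s2 // eq_s; rewrite last_rcons.
have {IHs} := IHs (a :: s2); rewrite -cat_rcons => /(_ eq_s) Pl.
have l_s : last x s1 \in x :: s.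
  by rewrite eq_s cat_rcons -cat_cons mem_cat mem_last.
have -> : a = next p (last x s1); last by apply: stepP; rewrite -?Ms.
rewrite -Ns; case/lastP: s1 eq_s Us {Pl l_s} => [|s1 b] ->.
  by rewrite /= eqxx.
rewrite last_rcons !cat_rcons -cat_cons => Us.
by rewrite next_split.
Qed.

(** [e] orients a complete multipartite graph whose partite sets are the classes of
    [sm].  Only this relation enters the arguments about merging cycles, and it does
    not change when all arcs are reversed. *)
Definition multipartite_arcs (T : Type) (e sm : rel T) : Prop :=
  [/\ equivalence_rel sm, forall u v, sm u v -> ~~ e u v
    & forall u v, ~~ sm u v -> e u v (+) e v u].

Definition converse (T : Type) (e : rel T) : rel T := fun u v => e v u.

Lemma equivalence_sym (T : Type) (sm : rel T) :
  equivalence_rel sm -> symmetric sm.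
Proof.
move=> eqv x y; apply/idP/idP=> h.
  by have [_ /(_ h) <-] := eqv x y x; case: (eqv x x x).
by have [_ /(_ h) <-] := eqv y x y; case: (eqv y y y).
Qed.

Lemma multipartite_converse (T : Type) (e sm : rel T) :
  multipartite_arcs e sm -> multipartite_arcs (converse e) sm.
Proof.
case=> eqv ind tot; split=> // u v; last by move/tot; rewrite addbC.
by rewrite (equivalence_sym eqv); apply: ind.
Qed.

Section Merging.

Variables (T : eqType) (e sm : rel T).
Hypothesis multi : multipartite_arcs e sm.

Lemma smxx x : sm x x. Proof. by case: multi => eqv _ _; case: (eqv x x x). Qed.

Lemma sm_sym x y : sm x y = sm y x.
Proof. by case: multi => eqv _ _; apply: equivalence_sym. Qed.

Lemma sm_trans y x z : sm x y -> sm y z -> sm x z.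
Proof. by case: multi => eqv _ _; have [_ h] := eqv x y z => /h ->. Qed.

Lemma arc_nsm x y : e x y -> ~~ sm x y.
Proof. by case: multi => _ ind _; apply/contraL/ind. Qed.

Lemma arc_nsm' x y : e x y -> ~~ sm y x.
Proof. by rewrite sm_sym; apply: arc_nsm. Qed.

Lemma arc_asym x y : e x y -> ~~ e y x.
Proof.
move=> exy; case: multi => _ _ /(_ x y (arc_nsm exy)).
by rewrite exy.
Qed.

Lemma arc_irr x : ~~ e x x.
Proof. by apply/negP=> h; move: (arc_nsm h); rewrite smxx. Qed.

Lemma arc_total x y : ~~ sm x y -> ~~ e y x -> e x y.
Proof. by case: multi => _ _ tot /tot; case: (e x y) => //= ->. Qed.

Lemma nsm_left x y z : sm x y -> e y z -> ~~ sm x z.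
Proof.
move=> xy /arc_nsm; apply: contra => xz.
by apply: sm_trans xz; rewrite sm_sym.
Qed.

Lemma nsm_right x y z : sm x y -> e z y -> ~~ sm x z.
Proof.
move=> xy /arc_nsm'; apply: contra => xz.
by apply: sm_trans xz; rewrite sm_sym.
Qed.

Lemma cycle_size_ge3 p : cycle e p -> p != [::] -> 2 < size p.
Proof.
case: p => [|a [|b [|c p]]] //=; first by rewrite andbT (negbTE (arc_irr a)).
by rewrite andbT => /andP[/arc_asym/negbTE->].
Qed.

Definition fits (p s : seq T) : bool :=
  has (fun g => e g (head g s) && e (last g s) (next p g)) p.

Definition mergeable (p1 p2 : seq T) : Prop :=
  exists2 q, cycle e q & perm_eq q (p1 ++ p2).

Lemma fitsP p s :
  reflect (exists g, [/\ g \in p, e g (head g s) & e (last g s) (next p g)])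
          (fits p s).
Proof.
by apply: (iffP hasP) => [[g ? /andP[]]|[g [? ? ?]]]; exists g => //; apply/andP.
Qed.

(** The last clause keeps all other gaps of [p] available for later insertions. *)
Lemma insert_path p g s :
    uniq (p ++ s) -> cycle e p -> g \in p -> sorted e s ->
    e g (head g s) -> e (last g s) (next p g) ->
  exists q, [/\ cycle e q, perm_eq q (p ++ s)
              & {in p, forall h, h != g -> next q h = next p h}].
Proof.
move=> Ups Cp gp; case: s Ups => [|a s] Ups Ss /= ga last_s.
  by rewrite (negbTE (arc_irr g)) in ga.
case/rot_to: (gp) => i u ri.
have [Up _] : uniq p /\ true by move: Ups; rewrite cat_uniq => /andP[].
have [Ugu Ngu _ Mgu] := rot_uniq_next Up ri.
have Cgu : cycle e (g :: u) by rewrite -ri rot_cycle.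
have pe : perm_eq (g :: (a :: s) ++ u) (p ++ a :: s).
  have pe1 : perm_eq p (g :: u) by rewrite -ri perm_sym perm_rot.
  apply: (@perm_trans _ ((g :: u) ++ a :: s)); last by rewrite perm_cat2r perm_sym.
  by rewrite [X in perm_eq _ X]cat_cons perm_cons perm_catC.
exists (g :: (a :: s) ++ u); split=> //.
  rewrite /= ga rcons_cat cat_path /= (Ss : path e a s) /=.
  move: last_s Cgu; rewrite -Ngu; case: (u) => [|b v] /=.
    by rewrite eqxx => ->.
  by rewrite eqxx => -> /andP[].
move=> h; rewrite -Mgu inE => /orP[/eqP->|hu]; first by rewrite eqxx.
move=> hg; rewrite -Ngu.
case/splitPr: hu pe Ugu => u1 u2 pe Ugu.
have eq2 : g :: (a :: s) ++ u1 ++ h :: u2 = (g :: (a :: s) ++ u1) ++ h :: u2.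
  by rewrite /= -catA.
rewrite eq2 next_split; last by rewrite -eq2 (perm_uniq pe).
by rewrite -[g :: u1 ++ _]/((g :: u1) ++ _) next_split //; case: u2 {pe Ugu eq2}.
Qed.

(** The segments may share gaps, so they cannot simply be inserted one after the
    other.  Let [g] be the gap of the first segment [s].  If the last vertex of a later
    segment [t] also has an arc to [next p g], the whole stretch from [s] to [t] fits
    into the gap [g] and counts as a single segment.  Otherwise no other segment uses
    the gap [g], and inserting [s] there leaves the remaining gaps untouched. *)
Lemma multi_insertion ss p :
    uniq (p ++ flatten ss) -> cycle e p -> sorted e (flatten ss) ->
    all (fits p) ss ->
  mergeable p (flatten ss).
Proof.
have [n le_n] := ubnP (size ss).
elim: n => // n IHn in ss p le_n *.
case: ss le_n => [|s ss] le_n Ups Cp Ss /=.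
  by exists p => //; rewrite cats0.
case/andP=> /fitsP[g [gp g_s s_g]] fit_ss.
have [/hasP[t t_ss t_g]|no_t] := boolP (has (fun t => e (last g t) (next p g)) ss).
  case/splitPr: t_ss Ups le_n fit_ss Ss => l r Ups le_n.
  rewrite all_cat /= => /and3P[_ /fitsP[g' [_ g't _]] fit_r] Ss.
  have eqF : flatten (s :: l ++ t :: r) = flatten ((s ++ flatten l ++ t) :: r).
    by rewrite /= flatten_cat /= -!catA.
  rewrite -[s ++ _]/(flatten (s :: l ++ t :: r)) eqF.
  apply: IHn; rewrite -?eqF //; first by move: le_n; rewrite /= size_cat /=; lia.
  rewrite /= fit_r andbT; apply/fitsP; exists g; split=> //.
    by case: (s) g_s => //=; rewrite (negbTE (arc_irr g)).
  rewrite !last_cat; case: (t) g't t_g => //=.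
  by rewrite (negbTE (arc_irr g')).
have [Ss1 Ss2] : sorted e s /\ sorted e (flatten ss).
  by case: (cat_sorted2 Ss).
have Ups1 : uniq (p ++ s).
  by move: Ups; rewrite /= catA cat_uniq => /andP[].
have [q [Cq pq Nq]] := insert_path Ups1 Cp gp Ss1 g_s s_g.
have pq2 : perm_eq (q ++ flatten ss) (p ++ flatten (s :: ss)).
  by rewrite /= catA perm_cat2r.
suff [q' Cq' pq'] : mergeable q (flatten ss).
  by exists q' => //; apply: perm_trans pq2.
apply: IHn => //; first by rewrite (perm_uniq pq2).
apply/allP=> t t_ss; have /fitsP[h [hp h_t t_h]] := allP fit_ss t t_ss.
apply/fitsP; exists h; split=> //; first by rewrite (perm_mem pq) mem_cat hp.
rewrite Nq //; apply/eqP=> hg; move/hasPn/(_ t t_ss)/negP: no_t; apply.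
by rewrite -hg.
Qed.


Definition unmergeable (p1 p2 : seq T) : Prop :=
  [/\ uniq (p1 ++ p2), cycle e p1, cycle e p2 & ~ mergeable p1 p2].

Definition dominates (p1 p2 : seq T) : Prop :=
  {in p1 & p2, forall a b, e b a -> sm (next p2 b) (prev p1 a)}.

Lemma unmergeableC p1 p2 : unmergeable p1 p2 -> unmergeable p2 p1.
Proof.
case=> U C1 C2 N; split=> //; first by rewrite uniq_catC.
case=> q Cq pq; apply: N; exists q => //.
by rewrite (perm_trans pq) // perm_catC.
Qed.

Lemma unmergeable_uniq p1 p2 : unmergeable p1 p2 -> uniq p1 /\ uniq p2.
Proof. by case; rewrite cat_uniq => /and3P[]. Qed.

(** The form in which [multi_insertion] is used: [p2] is cut open anywhere and then
    divided into segments. *)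
Lemma segments_do_not_fit p1 p2 i ss :
  unmergeable p1 p2 -> rot i p2 = flatten ss -> ~~ all (fits p1) ss.
Proof.
case=> U C1 C2 N ri; apply/negP=> fit_ss; apply: N.
have pe : perm_eq (p1 ++ flatten ss) (p1 ++ p2).
  by rewrite perm_cat2l -ri perm_rot.
have [||q Cq pq] := multi_insertion _ C1 _ fit_ss.
- by rewrite (perm_uniq pe).
- by rewrite -ri; apply: cycle_sorted; rewrite rot_cycle.
- by exists q => //; apply: perm_trans pe.
Qed.

Lemma rot_at p x : uniq p -> x \in p -> cycle e p ->
  exists i w, [/\ rot i p = x :: w, head x w = next p x, last x w = prev p x,
                  w != [::] & next p x \in w].
Proof.
move=> Up xp Cp; case/rot_to: (xp) => i w ri; exists i, w.
have [Uw Nw Pw _] := rot_uniq_next Up ri.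
have wn : w != [::].
  have: 2 < size (rot i p).
    by rewrite size_rot cycle_size_ge3 //; case: (p) xp.
  by rewrite ri; case: (w).
rewrite -Nw -Pw (@next_split _ [::]) // (@prev_split _ [::]) // cats0.
split=> //; by case: (w) wn => // a t _; rewrite inE eqxx.
Qed.

(** Otherwise [p2], cut open behind [b], would fit into the gap behind [a]. *)
Lemma exchange p1 p2 a b :
    unmergeable p1 p2 -> a \in p1 -> b \in p2 ->
  e a (next p2 b) -> ~~ e b (next p1 a).
Proof.
move=> U ap bp ab; have [U1 U2] := unmergeable_uniq U.
have [i [w ri]] := rot_to_last bp.
have [Uw Nw _ _] := rot_uniq_next U2 ri.
apply/negP=> ba; have eqF : rot i p2 = flatten [:: rcons w b] by rewrite /= cats0.
have /negP[] := segments_do_not_fit U eqF.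
rewrite /= andbT; apply/fitsP; exists a; rewrite last_rcons; split=> //.
by move: ab; rewrite -Nw -cats1 next_split ?cats1 //; case: (w).
Qed.

(** Walk along [p1] from the vertex [x], which has no in-neighbour on [p2], and
    look for the first back arc that violates domination, say from [b] to the vertex
    after [a'].  With [b'] and [b''] following [b] on [p2], and [a] preceding [a'] on
    [p1], the exchange rule and domination at [a] and [a'] yield the arcs
    [a -> b' -> a' -> b''], and the two cycles merge: [b'] goes between [a] and [a'],
    and the rest of [p2] goes behind [a']. *)
Lemma singular_dominates p1 p2 x :
    unmergeable p1 p2 -> x \in p1 -> {in p2, forall b, ~~ e b x} ->
  dominates p1 p2.
Proof.
move=> U xp no_in; have [U1 U2] := unmergeable_uniq U.
have [_ C1 C2 _] := U.
pose Pi a := {in p2, forall b, e b a -> sm (next p2 b) (prev p1 a)}.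
suff PiP : {in p1, forall a, Pi a /\ Pi (next p1 a)}.
  by move=> a b ap bp; apply: (PiP a ap).1.
have mn2 b : b \in p2 -> next p2 b \in p2 by rewrite mem_next.
have mn1 b : b \in p1 -> next p1 b \in p1 by rewrite mem_next.
have arc2 b : b \in p2 -> e b (next p2 b) by move=> ?; apply: next_cycle.
have arc1 b : b \in p1 -> e b (next p1 b) by move=> ?; apply: next_cycle.
apply: (next_ind U1 xp) => [|a ap [Pa Pa']].
  split=> [b bp|b bp bx]; first by rewrite (negbTE (no_in b bp)).
  rewrite prev_next //; apply/negPn/negP=> nsm.
  have /negP[] := no_in _ (mn2 b bp); apply: arc_total => //.
  by apply: contraL bx => /(exchange U xp bp).
split=> // b bp; set a' := next p1 a => ba''; rewrite prev_next //.
set b' := next p2 b; apply/negPn/negP=> nsm.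
have a'p : a' \in p1 by apply: mn1.
have b'p : b' \in p2 by apply: mn2.
have ba' : e b' a'.
  by apply: arc_total => //; apply: contraL ba'' => /(exchange U a'p bp).
set b'' := next p2 b'; have b''p : b'' \in p2 by apply: mn2.
have b''a : sm b'' a by have := Pa' _ b'p ba'; rewrite prev_next.
have ab'' : sm a b'' by rewrite sm_sym.
(* [a -> b'] and [a' -> b'']: the reverse arcs would make consecutive vertices
   of a cycle lie in the same partite set *)
have ab' : e a b'.
  apply: arc_total; first exact: nsm_right ab'' (arc2 _ b'p).
  apply/negP=> /(Pa _ b'p) /(sm_trans ab'').
  by apply/negP/arc_nsm'/prev_cycle.
have a'b'' : e a' b''.
  apply: arc_total; first by rewrite sm_sym; apply: nsm_left b''a (arc1 _ ap).
  apply/negP=> /(Pa' _ b''p); rewrite prev_next // => /sm_trans/(_ ab'').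
  by apply/negP/arc_nsm'/arc2.
have [i [w [ri hw lw w0 _]]] := rot_at U2 b'p C2.
have eqF : rot i p2 = flatten [:: [:: b']; w] by rewrite /= cats0.
have /negP[] := segments_do_not_fit U eqF.
rewrite /= andbT; apply/andP; split; apply/fitsP; [exists a|exists a'] => //=.
move: hw lw; rewrite prev_next //; case: (w) w0 => //= c w' _.
by rewrite -/b'' => -> ->.
Qed.

(** Around [p] the vertices that dominate [x] are followed, sooner or later, by one
    that [x] dominates.  As [x] does not fit into [p], the two kinds are separated by
    a single vertex in the partite set of [x]. *)
Lemma active_mate p x b0 b1 :
    uniq p -> b0 \in p -> e b0 x -> b1 \in p -> e x b1 -> cycle e p ->
    ~~ fits p [:: x] ->
  exists b, [/\ b \in p, e b x, sm (next p b) x & e x (next p (next p b))].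
Proof.
move=> Up b0p b0x b1p xb1 Cp nofit.
pose act b := [&& e b x, sm (next p b) x & e x (next p (next p b))].
have [/hasP[b bp /and3P[? ? ?]]|no_act] := boolP (has act p); first by exists b.
have step b : b \in p -> e b x -> ~~ e x (next p b).
  move=> bp bx; apply: contra nofit => xb; apply/fitsP; exists b => //=.
have : {in p, forall b, e b x || sm b x && e (prev p b) x}.
  apply: (next_ind Up b0p) => [|b bp]; first by rewrite b0x.
  rewrite prev_next // => /orP[bx|/andP[bs pbx]].
    have [xs|xs] := boolP (sm x (next p b)); first by rewrite sm_sym xs bx orbT.
    by rewrite (arc_total _ (step b bp bx)) // sm_sym.
  have nbx : ~~ e x (next p b).
    apply: contra no_act => xb; apply/hasP; exists (prev p b).
      by rewrite mem_prev.
    by rewrite /act next_prev // pbx bs.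
  rewrite (arc_total _ nbx) // sm_sym.
  by apply: nsm_left (next_cycle Cp bp); rewrite sm_sym.
move=> /(_ b1 b1p) /orP[/arc_asym|/andP[b1x _]]; first by rewrite xb1.
by move: (arc_nsm' xb1); rewrite b1x.
Qed.

Lemma pairs_fit p w :
    sorted (fun a b => fits p [:: a; b]) w -> ~~ odd (size w) ->
  exists2 ss, flatten ss = w & all (fits p) ss.
Proof.
have [n le_n] := ubnP (size w); elim: n => // n IHn in w le_n *.
case: w le_n => [|a [|b w]] //= le_n; first by exists [::].
case/andP=> ab Sbw; rewrite negbK => ev.
have [||ss eq_ss fit_ss] := IHn w _ _ ev.
- by lia.
- by case: (w) Sbw => //= c w' /andP[].
- by exists ([:: a; b] :: ss); rewrite /= ?eq_ss ?ab.
Qed.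

Lemma singles_and_pairs_fit p w x :
    sorted (fun a b => fits p [:: a] || fits p [:: a; b]) (rcons w x) ->
    fits p [:: x] ->
  exists2 ss, flatten ss = rcons w x & all (fits p) ss.
Proof.
move=> + fit_x; have [n le_n] := ubnP (size w); elim: n => // n IHn in w le_n *.
case: w le_n => [|a w] /= le_n; first by exists [:: [:: x]]; rewrite //= fit_x.
move=> Rw; have [fit_a|nofit_a] := boolP (fits p [:: a]).
  have [|ss eq_ss fit_ss] := IHn w _ (path_sorted Rw); first by lia.
  by exists ([:: a] :: ss); rewrite /= ?eq_ss ?fit_a.
case: w le_n Rw => [|b w] /= le_n; rewrite (negbTE nofit_a) /= => /andP[fit_ab Rw].
  by exists [:: [:: a; x]]; rewrite //= fit_ab.
have [|ss eq_ss fit_ss] := IHn w _ (path_sorted Rw); first by lia.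
by exists ([:: a; b] :: ss); rewrite /= ?eq_ss ?fit_ab.
Qed.

Definition nonsingular (p1 p2 : seq T) : Prop :=
  {in p1, forall x, (exists2 b, b \in p2 & e b x) /\ (exists2 b, b \in p2 & e x b)}.

(** By [active_mate] there is a vertex [y] on [p2] in the partite set of [x] such
    that [x] could take the place of [y] on [p2].  The exchange rule for [x] and [y]
    gives the last arc, whence the path from [x] to [next p1 x] fits just before [y]. *)
Lemma misfit_pair_fits p1 p2 x :
    unmergeable p1 p2 -> nonsingular p1 p2 -> x \in p1 -> ~~ fits p2 [:: x] ->
  exists b, [/\ b \in p2, e b x, sm (next p2 b) x, e x (next p2 (next p2 b))
               & e (next p1 x) (next p2 b)].
Proof.
move=> U ns xp nofit; have [U1 U2] := unmergeable_uniq U.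
have [_ C1 C2 _] := U.
have [[b0 b0p b0x] [b1 b1p xb1]] := ns x xp.
have [b [bp bx yx xy']] := active_mate U2 b0p b0x b1p xb1 C2 nofit.
exists b; split=> //.
have yp : next p2 b \in p2 by rewrite mem_next.
apply: arc_total; last exact: (exchange U xp yp xy').
by rewrite sm_sym; apply: nsm_left yx (next_cycle C1 xp).
Qed.

Lemma single_or_pair_fits p1 p2 :
    unmergeable p1 p2 -> nonsingular p1 p2 ->
  {in p1, forall x, fits p2 [:: x] || fits p2 [:: x; next p1 x]}.
Proof.
move=> U ns x xp; have [//|nofit /=] := boolP (fits p2 [:: x]).
have [b [bp bx _ _ xy]] := misfit_pair_fits U ns xp nofit.
by apply/fitsP; exists b.
Qed.

(** If one vertex fits, cut [p1] open behind it and divide the resulting path, from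
    left to right, into fitting single vertices and fitting pairs: the last vertex
    never needs a partner. *)
Lemma all_misfit p1 p2 :
    unmergeable p1 p2 -> nonsingular p1 p2 ->
  {in p1, forall x, ~~ fits p2 [:: x]}.
Proof.
move=> U ns x xp; apply/negP=> fit_x; have [U1 U2] := unmergeable_uniq U.
have [i [w ri]] := rot_to_last xp; have [Uw Nw _ Mw] := rot_uniq_next U1 ri.
have [|ss eq_ss fit_ss] := @singles_and_pairs_fit p2 w x _ fit_x.
  apply: cycle_sorted; apply: cycle_from_next => // a.
  by rewrite Mw Nw; apply: single_or_pair_fits.
have eqF : rot i p1 = flatten ss by rewrite eq_ss.
by have /negP[] := segments_do_not_fit (unmergeableC U) eqF.
Qed.

Lemma even_block_fits p1 p2 i u w :
    unmergeable p1 p2 -> nonsingular p1 p2 -> rot i p1 = u ++ w ->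
    ~~ odd (size w) ->
  exists2 ss, flatten ss = w & all (fits p2) ss.
Proof.
move=> U ns ri ev; have [U1 U2] := unmergeable_uniq U.
have [Uw Nw _ Mw] := rot_uniq_next U1 ri.
apply: pairs_fit => //.
have : sorted (fun a b => fits p2 [:: a; b]) (u ++ w).
  apply: cycle_sorted; apply: cycle_from_next => // a.
  rewrite Mw Nw => ap; have := single_or_pair_fits U ns ap.
  by rewrite (negbTE (all_misfit U ns ap)).
by case/cat_sorted2.
Qed.

(** The vertices outside an odd block would form consecutive fitting pairs. *)
Lemma odd_block_misfits p1 p2 i u w :
    unmergeable p1 p2 -> nonsingular p1 p2 -> rot i p1 = u ++ w ->
    ~~ odd (size w) ->
  ~~ fits p2 u.
Proof.
move=> U ns ri ev; apply/negP=> fit_u.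
have [ss eq_ss fit_ss] := even_block_fits U ns ri ev.
have eqF : rot i p1 = flatten (u :: ss) by rewrite /= eq_ss.
have /negP[] := segments_do_not_fit (unmergeableC U) eqF.
by rewrite /= fit_u.
Qed.

(** By [all_misfit] no vertex of one cycle fits into the other, and [p1] has odd
    length because it cannot be divided into pairs.  Choose [y] on [p2] in the partite
    set of a vertex [x] of [p1] as in [misfit_pair_fits].  Odd blocks of [p1] starting
    or ending at [x] do not fit next to [y], and [y] does not fit into [p1]; by
    induction, every second vertex after [x] lies in the partite set of [y].  After a
    full turn this reaches the predecessor of [x], although it has an arc to [x]. *)
Lemma nonsingular_mergeable p1 p2 :
  unmergeable p1 p2 -> nonsingular p1 p2 -> nonsingular p2 p1 -> p1 = [::].
Proof.
move=> U ns1 ns2; have [U1 U2] := unmergeable_uniq U.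
have [_ C1 C2 _] := U.
case: (altP (p1 =P [::])) => // p1n0.
have [x xp] : exists x, x \in p1 by case: (p1) p1n0 => // x t _; exists x; apply: mem_head.
have odd1 : odd (size p1).
  apply/negPn/negP=> ev; have r0 : rot 0 p1 = [::] ++ p1 by rewrite rot0.
  have [ss eq_ss fit_ss] := even_block_fits U ns1 r0 ev.
  have eqF : rot 0 p1 = flatten ss by rewrite r0 eq_ss.
  by have /negP[] := segments_do_not_fit (unmergeableC U) eqF.
have [b [bp bx yx xy' _]] := misfit_pair_fits U ns1 xp (all_misfit U ns1 xp).
move: yx xy'; set y := next p2 b => yx xy'.
have yp : y \in p2 by rewrite mem_next.
have /fitsP y_misfit := all_misfit (unmergeableC U) ns2 yp.
case/rot_to: (xp) => i s ri; have [Us Ns _ Ms] := rot_uniq_next U1 ri.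
have even_s : ~~ odd (size s).
  by move: odd1; rewrite -(size_rot i p1) ri /=.
have Cs : cycle e (x :: s) by rewrite -ri rot_cycle.
suff same n : forall s1 s2, s = s1 ++ s2 -> size s1 = n.*2 -> sm y (last x s1).
  have := same (size s)./2 s [::]; rewrite cats0 even_halfK // => /(_ erefl erefl) ys.
  have : e (last x s) x by move: Cs; rewrite /= rcons_path => /andP[].
  by move/(nsm_right yx); rewrite ys.
elim: n => [|n IHn] s1 s2 eq_s; first by case: s1 eq_s.
case/lastP: s1 eq_s => // s1 z2; case/lastP: s1 => // s1 z1.
rewrite !size_rcons !cat_rcons doubleS => eq_s [] /[dup] sz1 /(IHn _ _ eq_s) yxk.
rewrite last_rcons.
have ev1 : ~~ odd (size s1) by rewrite sz1 odd_double.
have ev2 : ~~ odd (size s2).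
  by move: even_s; rewrite eq_s size_cat /= oddD (negbTE ev1) /= negbK.
have nyz1 : ~~ e y z1.
  have r1 : rot (rot_add p1 i (size (x :: s1))) p1
          = (z1 :: z2 :: s2 ++ [:: x]) ++ s1.
    by rewrite -rot_rot_add ri eq_s -[x :: s1 ++ _]/((x :: s1) ++ _) rot_size_cat /= -catA.
  apply: contra (odd_block_misfits U ns1 r1 ev1) => yz1.
  by apply/fitsP; exists y => /=; rewrite last_cat.
have nz2y : ~~ e z2 y.
  have r2 : rot i p1 = (x :: s1 ++ [:: z1; z2]) ++ s2.
    by rewrite ri eq_s /= -catA.
  apply: contra (odd_block_misfits U ns1 r2 ev2) => z2y.
  by apply/fitsP; exists b => /=; rewrite last_cat.
have xkz1 : e (last x s1) z1.
  by move: (cycle_sorted Cs); rewrite eq_s /= cat_path /= => /and3P[].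
have z1y : e z1 y.
  by apply: arc_total => //; rewrite sm_sym; apply: nsm_left xkz1.
have z1p : z1 \in p1 by rewrite -Ms eq_s inE mem_cat inE eqxx !orbT.
have next_z1 : next p1 z1 = z2.
  by rewrite -Ns eq_s -[x :: s1 ++ _]/((x :: s1) ++ _) next_split //= -eq_s.
rewrite sm_sym; apply/negPn/negP=> nsm; have /negP[] := nz2y.
apply: arc_total => //; apply/negP=> yz2; apply: y_misfit.
by exists z1; rewrite /= next_z1.
Qed.

End Merging.

(** * Domination between cycles that cannot be merged *)

Lemma cycle_rev (T : Type) (e : rel T) p :
  cycle (converse e) (rev p) = cycle e p.
Proof. exact: rev_cycle. Qed.

Lemma mergeable_converse (T : eqType) (e : rel T) p1 p2 :
  mergeable (converse e) (rev p1) (rev p2) -> mergeable e p1 p2.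
Proof.
case=> q Cq pq; exists (rev q); first by rewrite -cycle_rev revK.
rewrite perm_rev (perm_trans pq) //.
by rewrite perm_cat // perm_rev.
Qed.

Lemma unmergeable_converse (T : eqType) (e : rel T) p1 p2 :
  unmergeable e p1 p2 -> unmergeable (converse e) (rev p1) (rev p2).
Proof.
case=> U C1 C2 N; split; rewrite ?cycle_rev //; last by move/mergeable_converse.
by rewrite -rev_cat rev_uniq uniq_catC.
Qed.

Section Dominance.

Variables (T : eqType) (e sm : rel T).
Hypothesis multi : multipartite_arcs e sm.

Lemma dominates_converse p1 p2 : uniq p1 -> uniq p2 ->
  dominates (converse e) sm (rev p1) (rev p2) <-> dominates e sm p2 p1.
Proof.
move=> U1 U2; split=> dom a b ap bp.
  move=> ba; have := dom b a; rewrite !mem_rev => /(_ bp ap ba).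
  by rewrite next_rev // prev_rev // (sm_sym multi).
rewrite !mem_rev in ap bp => ab; rewrite next_rev // prev_rev //.
by rewrite (sm_sym multi); apply: dom.
Qed.

(** A vertex with no in-neighbour, or no out-neighbour, on the other cycle starts
    the propagation of [singular_dominates], in the digraph or in its converse.  If
    there is no such vertex on either cycle, [nonsingular_mergeable] applies. *)
Lemma dominance p1 p2 :
  unmergeable e p1 p2 -> dominates e sm p1 p2 \/ dominates e sm p2 p1.
Proof.
move=> U; have [U1 U2] := unmergeable_uniq U.
have multi' := multipartite_converse multi.
have U' := unmergeable_converse U.
have [/hasP[x xp /allP no]|/hasPn sg1] := boolP (has (fun x => all (fun b => ~~ e b x) p2) p1).
  by left; apply: (singular_dominates multi U xp).
have [/hasP[x xp /allP no]|/hasPn sg2] := boolP (has (fun x => all (fun b => ~~ e x b) p2) p1).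
  right; apply/dominates_converse => //.
  apply: (singular_dominates multi' U' (x := x)); first by rewrite mem_rev.
  by move=> b; rewrite mem_rev => /no.
have [/hasP[x xp /allP no]|/hasPn sg3] := boolP (has (fun x => all (fun b => ~~ e b x) p1) p2).
  by right; apply: (singular_dominates multi (unmergeableC U) xp).
have [/hasP[x xp /allP no]|/hasPn sg4] := boolP (has (fun x => all (fun b => ~~ e x b) p1) p2).
  left; apply/dominates_converse => //.
  apply: (singular_dominates multi' (unmergeableC U') (x := x)); first by rewrite mem_rev.
  by move=> b; rewrite mem_rev => /no.
left; suff -> : p1 = [::] by [].
apply: (nonsingular_mergeable multi U) => x xp; split.
- by have /allPn[b ? /negPn] := sg1 x xp; exists b.
- by have /allPn[b ? /negPn] := sg2 x xp; exists b.
- by have /allPn[b ? /negPn] := sg3 x xp; exists b.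
- by have /allPn[b ? /negPn] := sg4 x xp; exists b.
Qed.

(** Thus a back arc from [b] to [a] lets [b] slip between the predecessor of [a] and
    [a], and [a] between [b] and the successor of [b]. *)
Lemma back_arc p1 p2 a b :
    uniq p1 -> uniq p2 -> cycle e p1 -> cycle e p2 -> dominates e sm p1 p2 ->
    a \in p1 -> b \in p2 -> e b a ->
  e (prev p1 a) b /\ e a (next p2 b).
Proof.
move=> U1 U2 C1 C2 dom ap bp ba; have same := dom a b ap bp ba.
have pap : prev p1 a \in p1 by rewrite mem_prev.
have nbp : next p2 b \in p2 by rewrite mem_next.
have same' : sm (prev p1 a) (next p2 b) by rewrite (sm_sym multi).
split; apply: (arc_total multi).
- exact: (nsm_right multi same') (next_cycle C2 bp).
- apply/negP=> /(dom _ _ pap bp) /(sm_trans multi same').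
  by apply/negP/(arc_nsm' multi)/prev_cycle.
- by rewrite (sm_sym multi); apply: (nsm_left multi same); apply: prev_cycle.
apply/negP=> /(dom _ _ ap nbp); rewrite (sm_sym multi).
move/(sm_trans multi same); apply/negP/(arc_nsm multi).
exact: next_cycle.
Qed.

Lemma avoid_parts p u w :
    uniq p -> cycle e p -> p != [::] -> ~~ sm u w ->
  exists b, [/\ b \in p, ~~ sm u b & ~~ sm w (prev p b)].
Proof.
move=> Up Cp p0 uw.
have [/hasP[b bp /andP[? ?]]|/hasPn none] :=
  boolP (has (fun b => ~~ sm u b && ~~ sm w (prev p b)) p); first by exists b.
have only_w b : b \in p -> sm w (prev p b).
  move=> bp; apply/negPn/negP=> wb.
  have ub : sm u b by move: (none b bp); rewrite wb andbT negbK.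
  have nbp : next p b \in p by rewrite mem_next.
  move: (none _ nbp); rewrite prev_next // (nsm_left multi ub (next_cycle Cp bp)) /=.
  rewrite negbK => wb'; case/negP: uw; apply: (sm_trans multi ub).
  by rewrite (sm_sym multi).
have [b bp] : exists b, b \in p by case: (p) p0 => // b t _; exists b; apply: mem_head.
have pbp : prev p b \in p by rewrite mem_prev.
have := nsm_right multi (only_w b bp) (prev_cycle Cp pbp).
by rewrite only_w.
Qed.

Lemma rot_ends p h : uniq p -> h \in p -> cycle e p ->
  exists i x t l, [/\ rot i p = h :: rcons (x :: t) l, l = prev p h, x = next p h
                   & last x t = prev p l].
Proof.
move=> Up hp Cp; case/rot_to: (hp) => i w ri; exists i.
have [Uw Nw Pw _] := rot_uniq_next Up ri.
have : 2 < size (rot i p).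
  by rewrite size_rot (cycle_size_ge3 multi) //; case: (p) hp.
rewrite ri; case: w ri Uw Nw Pw => [|x w]//; case/lastP: w => // t l ri Uw Nw Pw _.
exists x, t, l; rewrite -!Pw -!Nw; split=> //.
- by rewrite (@prev_split _ [::]) // cats0 /= last_rcons.
- by rewrite (@next_split _ [::]).
rewrite -cats1 -[_ :: _ :: _ ++ _]/((h :: x :: t) ++ [:: l]) prev_split //.
by rewrite /= cats1.
Qed.

(** How to pass from [p1] to [p2] when [p1] is left behind the vertex before [h1] and
    [p2] is entered at [h2].  If the arc between these two vertices points back, then
    by [back_arc] they can be visited in the opposite order. *)
Lemma junction p1 p2 h1 h2 :
    uniq p1 -> uniq p2 -> cycle e p1 -> cycle e p2 -> dominates e sm p1 p2 ->
    h1 \in p1 -> h2 \in p2 -> ~~ sm (prev p1 h1) h2 ->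
  exists2 J, perm_eq J [:: prev p1 h1; h2]
           & path e (prev p1 (prev p1 h1)) (rcons J (next p2 h2)).
Proof.
move=> U1 U2 C1 C2 dom hp1 hp2 nsm; set l := prev p1 h1.
have lp : l \in p1 by rewrite mem_prev.
have [h2l|nh2l] := boolP (e h2 l).
  have [lh lh'] := back_arc U1 U2 C1 C2 dom lp hp2 h2l.
  exists [:: h2; l]; last by rewrite /= lh h2l lh'.
  by rewrite -[[:: h2; l]]/([:: h2] ++ [:: l]) perm_catC.
exists [:: l; h2] => //=.
by rewrite (arc_total multi nsm nh2l) prev_cycle // next_cycle.
Qed.

(** The three cycles are run through one after the other.  The vertices [a], [b],
    [c] where they are entered are chosen such that none lies in the partite set of
    the last vertex of the preceding cycle; [junction] then provides the passages. *)
Lemma dominance_triangle_merges p1 p2 p3 :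
    uniq p1 -> uniq p2 -> uniq p3 -> cycle e p1 -> cycle e p2 -> cycle e p3 ->
    p1 != [::] -> p2 != [::] -> p3 != [::] ->
    dominates e sm p1 p2 -> dominates e sm p2 p3 -> dominates e sm p3 p1 ->
  exists2 q, cycle e q & perm_eq q (p1 ++ p2 ++ p3).
Proof.
move=> U1 U2 U3 C1 C2 C3 n1 n2 n3 d12 d23 d31.
have [a ap] : exists a, a \in p1 by case: (p1) n1 => // b t _; exists b; apply: mem_head.
have pa := arc_nsm multi (prev_cycle C1 ap).
have [b [bp nab nab']] := avoid_parts U2 C2 n2 pa.
have [c [cp nbc nac]] : exists c, [/\ c \in p3, ~~ sm (prev p2 b) c & ~~ sm a (prev p3 c)].
  by apply: avoid_parts; rewrite // (sm_sym multi).
rewrite (sm_sym multi) in nac.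
have [J12 P12 path12] := junction U1 U2 C1 C2 d12 ap bp nab.
have [J23 P23 path23] := junction U2 U3 C2 C3 d23 bp cp nbc.
have [J31 P31 path31] := junction U3 U1 C3 C1 d31 cp ap nac.
have [i1 [x1 [t1 [l1 [r1 e1 f1 g1]]]]] := rot_ends U1 ap C1.
have [i2 [x2 [t2 [l2 [r2 e2 f2 g2]]]]] := rot_ends U2 bp C2.
have [i3 [x3 [t3 [l3 [r3 e3 f3 g3]]]]] := rot_ends U3 cp C3.
rewrite -e1 -g1 -f2 in path12; rewrite -e2 -g2 -f3 in path23.
rewrite -e3 -g3 -f1 in path31; rewrite -e1 in P12; rewrite -e2 in P23; rewrite -e3 in P31.
have inner p i h x t l : cycle e p -> rot i p = h :: rcons (x :: t) l -> path e x t.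
  move=> Cp ri; have : sorted e (rot i p) by apply: cycle_sorted; rewrite rot_cycle.
  by rewrite ri /= rcons_path => /and3P[].
have glue x t J y s : path e x t -> path e (last x t) (rcons J y) -> path e y s ->
    path e x (t ++ J ++ y :: s).
  by move=> pt pJ ps; rewrite cat_path pt -cat_rcons cat_path pJ last_rcons.
exists (x1 :: t1 ++ J12 ++ x2 :: t2 ++ J23 ++ x3 :: t3 ++ J31).
  rewrite /cycle; have -> : rcons (t1 ++ J12 ++ x2 :: t2 ++ J23 ++ x3 :: t3 ++ J31) x1
     = t1 ++ J12 ++ x2 :: t2 ++ J23 ++ x3 :: t3 ++ J31 ++ [:: x1].
    by rewrite -cats1 -!catA /= -!catA /= -!catA.
  apply: (glue _ _ _ _ _ (inner _ _ _ _ _ _ C1 r1) path12).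
  apply: (glue _ _ _ _ _ (inner _ _ _ _ _ _ C2 r2) path23).
  by apply: (glue _ _ _ _ _ (inner _ _ _ _ _ _ C3 r3) path31).
apply/permP=> f; have cnt p i s : rot i p = s -> count f p = count f s.
  by move=> <-; apply/permP; rewrite perm_sym perm_rot.
move/permP/(_ f): P12; move/permP/(_ f): P23; move/permP/(_ f): P31.
rewrite !count_cat (cnt _ _ _ r1) (cnt _ _ _ r2) (cnt _ _ _ r3).
rewrite /= !count_cat /= !count_cat /= !count_cat /= -!cats1 !count_cat /=.
repeat move: (nat_of_bool (f _)) => ?.
by move=> E1 E2 E3; clear - E1 E2 E3; lia.
Qed.

(** Write [d1], [d2], [d3] for the vertices after [d] on [p2] and [a1], [a2], [a3] for
    those before [a] on [p1].  A back arc from [d1] to [f] lets [d1] be inserted alone before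
    [f], so the rest of [p2] must not fit behind [a1]; this forces a back arc from
    [d2] to [a1].  Now the part of [p2] after [d2] does fit behind [a1], so the path
    from [d1] to [d2] must not fit behind [a2]; this forces a back arc from [d1] to
    [a2].  Then [d1], [d2] and the rest of [p2] fit behind [a3], [a2] and [a1]. *)
Lemma no_consecutive_back_arcs p1 p2 d a f :
    unmergeable e p1 p2 -> dominates e sm p1 p2 ->
    d \in p2 -> a \in p1 -> e d a -> f \in p1 ->
  ~~ e (next p2 d) f.
Proof.
move=> U dom dp ap da fp; have [U1 U2] := unmergeable_uniq U.
have [_ C1 C2 _] := U.
have m2 x : x \in p2 -> next p2 x \in p2 by rewrite mem_next.
have m1 x : x \in p1 -> prev p1 x \in p1 by rewrite mem_prev.
have arc2 x : x \in p2 -> e x (next p2 x) by move=> ?; apply: next_cycle.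
have back x y := @back_arc p1 p2 x y U1 U2 C1 C2 dom.
set d1 := next p2 d; apply/negP=> d1f; have d1p : d1 \in p2 by apply: m2.
have [fd1 _] := back _ _ fp d1p d1f.
set a1 := prev p1 a; have a1p : a1 \in p1 by apply: m1.
have same1 : sm a1 d1 by rewrite (sm_sym multi); apply: dom.
set d2 := next p2 d1; have d2p : d2 \in p2 by apply: m2.
set d3 := next p2 d2; have d3p : d3 \in p2 by apply: m2.
have na1 : next p1 a1 = a by apply: next_prev.
have [i [x [t [l [ri el ex _]]]]] := rot_ends U2 d1p C2.
rewrite /d1 prev_next // in el; rewrite -/d2 in ex; subst x l.
have hd3 : head d (rcons t d) = d3.
  have [Uw Nw _ _] := rot_uniq_next U2 ri.
  by rewrite /d3 -Nw -[next p2 d :: _]/([:: d1] ++ d2 :: rcons t d) next_split //; case: (t).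
have nfit ss : d1 :: d2 :: rcons t d = flatten ss -> ~~ all (fits e p1) ss.
  by move=> eqF; apply: (segments_do_not_fit multi U (i := i)); rewrite ri.
have fit3 : e a1 d3 -> fits e p1 (rcons t d).
  move=> a1d3; apply/fitsP; exists a1; rewrite last_rcons na1; split=> //.
  by move: hd3; case: (t) => [|? ?] /= ->.
have d2a1 : e d2 a1.
  apply: (arc_total multi).
    by rewrite (sm_sym multi); apply: (nsm_left multi same1); apply: arc2.
  apply/negP=> a1d2; have eqF : d1 :: d2 :: rcons t d = flatten [:: [:: d1]; d2 :: rcons t d].
    by rewrite /= cats0.
  have /negP[] := nfit _ eqF.
  rewrite /= andbT; apply/andP; split; apply/fitsP.
    by exists (prev p1 f); rewrite next_prev //; split; rewrite ?m1.
  by exists a1; rewrite /= last_rcons na1.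
have [a2d2 a1d3] := back _ _ a1p d2p d2a1.
set a2 := prev p1 a1 in a2d2; have a2p : a2 \in p1 by apply: m1.
have na2 : next p1 a2 = a1 by apply: next_prev.
have d1a2 : e d1 a2.
  apply: (arc_total multi).
    by apply: (nsm_right multi _ (prev_cycle C1 a1p)); rewrite (sm_sym multi).
  apply/negP=> a2d1; have eqF : d1 :: d2 :: rcons t d = flatten [:: [:: d1; d2]; rcons t d].
    by rewrite /= cats0.
  have /negP[] := nfit _ eqF.
  rewrite /= (fit3 a1d3) !andbT; apply/fitsP; exists a2.
  by rewrite na2.
have [a3d1 _] := back _ _ a2p d1p d1a2.
have eqF : d1 :: d2 :: rcons t d = flatten [:: [:: d1]; [:: d2]; rcons t d].
  by rewrite /= cats0.
have /negP[] := nfit _ eqF.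
rewrite /= (fit3 a1d3) !andbT; apply/andP; split; apply/fitsP.
  by exists (prev p1 a2); rewrite next_prev //; split; rewrite ?m1.
by exists a2; rewrite na2.
Qed.

End Dominance.

(** * Hall's theorem and cycle covers *)

Definition nbhd (T : finType) (R : rel T) (X : {set T}) : {set T} :=
  [set y | [exists x in X, R x y]].

Lemma nbhdP (T : finType) (R : rel T) (X : {set T}) y :
  reflect (exists2 x, x \in X & R x y) (y \in nbhd R X).
Proof. by rewrite inE; apply: exists_inP. Qed.

(** The induction of Halmos and Vaughan: if some proper nonempty [X] has exactly
    [#|X|] neighbours, match [X] and its complement separately; otherwise any arc may
    be removed together with its ends. *)
Theorem hall_marriage (T : finType) (R : rel T) (A : {set T}) :
    (forall X : {set T}, X \subset A -> #|X| <= #|nbhd R X|) ->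
  exists f : T -> T, {in A &, injective f} /\ {in A, forall x, R x (f x)}.
Proof.
have [n le_n] := ubnP #|A|; elim: n => // n IHn in R A le_n * => hall.
have [->|[a aA]] := set_0Vmem A.
  by exists id; split=> [x y|x]; rewrite inE.
have [/existsP[X /and4P[sXA X0 XnA tight]]|/existsPn loose] := boolP
  [exists X : {set T}, [&& X \subset A, X != set0, X != A & #|nbhd R X| <= #|X|]].
  have ltX : #|X| < #|A| by rewrite proper_card // properEneq XnA.
  have gtX : 0 < #|X| by rewrite card_gt0.
  have [|Z sZX|f1 [inj1 R1]] := IHn R X; first by lia.
    by apply: hall; apply: subset_trans sXA.
  pose R2 x y := R x y && (y \notin nbhd R X).
  have cardD : #|A :\: X| = #|A| - #|X| by rewrite cardsD (setIidPr sXA).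
  have [|Z sZ|f2 [inj2 R2f]] := IHn R2 (A :\: X); first by lia.
    have sXZ : X :|: Z \subset A.
      by rewrite subUset sXA (subset_trans sZ) // subsetDl.
    have dXZ : [disjoint X & Z].
      by rewrite disjoint_sym; move: sZ; rewrite subsetD => /andP[].
    have := hall _ sXZ; rewrite cardsU (disjoint_setI0 dXZ) cards0 subn0.
    have : nbhd R (X :|: Z) \subset nbhd R X :|: nbhd R2 Z.
      apply/subsetP=> y /nbhdP[x]; rewrite !inE => /orP[xX|xZ] Rxy.
        by apply/orP; left; apply/exists_inP; exists x.
      have [//|ny /=] := boolP [exists x in X, R x y].
      by apply/exists_inP; exists x; rewrite /R2 // Rxy inE.
    by move/subset_leq_card; have := cardsUI (nbhd R X) (nbhd R2 Z); lia.
  exists (fun x => if x \in X then f1 x else f2 x); split=> [x y xA yA|x xA].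
    have nX z : z \in A -> z \notin X -> f2 z \notin nbhd R X.
      by move=> zA zX; have /andP[] : R2 z (f2 z) by apply: R2f; rewrite inE zX.
    have inX z : z \in X -> f1 z \in nbhd R X.
      by move=> zX; apply/nbhdP; exists z; rewrite ?R1.
    have [xX|xX] := boolP (x \in X); have [yX|yX] := boolP (y \in X).
    - exact: inj1.
    - by move=> E; have := nX y yA yX; rewrite -E inX.
    - by move=> E; have := nX x xA xX; rewrite E inX.
    - by apply: inj2; rewrite inE ?xX ?yX.
  have [xX|xX] := boolP (x \in X); first exact: R1.
  by have /andP[] : R2 x (f2 x) by apply: R2f; rewrite inE xX.
have sa : [set a] \subset A by rewrite sub1set.
have := hall _ sa; rewrite cards1 => /card_gt0P[b /nbhdP[_ /set1P-> Rab]].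
pose R' x y := R x y && (y != b).
have cA : #|A :\ a| < #|A| by rewrite [#|A|](cardsD1 a) aA.
have [|X sX|f [inj Rf]] := IHn R' (A :\ a); first by lia.
  have [->|X0] := eqVneq X set0; first by rewrite cards0.
  have sXA : X \subset A by apply: subset_trans sX _; apply: subsetDl.
  have XnA : X != A.
    by apply: contraTneq sX => ->; rewrite subsetD1 aA andbF.
  have := loose X; rewrite sXA X0 XnA /= -ltnNge.
  have : nbhd R X \subset b |: nbhd R' X.
    apply/subsetP=> y /nbhdP[x xX Rxy]; rewrite !inE; have [//|yb /=] := eqVneq y b.
    by apply/exists_inP; exists x; rewrite /R' // Rxy.
  by move/subset_leq_card; rewrite cardsU1; case: (b \notin _) => /=; lia.
exists (fun x => if x == a then b else f x).
have fb x : x \in A -> x != a -> f x != b.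
  by move=> xA xa; have /andP[] : R' x (f x) by apply: Rf; rewrite !inE xa.
split=> [x y xA yA|x xA].
  have [->|xa] := eqVneq x a; have [->|ya] := eqVneq y a => //.
  - by move=> E; have := fb y yA ya; rewrite -E eqxx.
  - by move=> E; have := fb x xA xa; rewrite E eqxx.
  - by apply: inj; rewrite !inE ?xa ?ya.
have [->//|xa] := eqVneq x a.
by have /andP[] : R' x (f x) by apply: Rf; rewrite !inE xa.
Qed.

Definition cycle_cover (T : finType) (e : rel T) (H : {set T}) (cs : seq (seq T)) :=
  [/\ {in cs, forall p, cycle e p /\ p != [::]} & perm_eq (flatten cs) (enum H)].

(** The cycles are the orbits of [f]. *)
Lemma injection_cycle_cover (T : finType) (e : rel T) (H : {set T}) (f : T -> T) :
    {in H, forall x, f x \in H} -> {in H &, injective f} ->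
    {in H, forall x, e x (f x)} ->
  exists cs, cycle_cover e H cs.
Proof.
have [n le_n] := ubnP #|H|; elim: n => // n IHn in H le_n * => fH inj ef.
have [->|[x xH]] := set_0Vmem H.
  by exists [::]; split=> //; rewrite enum_set0.
have orbH y : y \in orbit f x -> y \in H.
  case/trajectP=> i _ ->; elim: i => //= i; exact: fH.
have Corb : fcycle f (orbit f x) by apply: cycle_orbit_in xH.
have Uorb : uniq (orbit f x) by apply: orbit_uniq.
have next_orb y : y \in orbit f x -> next (orbit f x) y = f y.
  by move=> yo; rewrite (nextE Corb).
pose H' := H :\: [set y in orbit f x].
have xo : x \in orbit f x by apply: in_orbit.
have [||||cs [cyc_cs perm_cs]] := IHn H'.
- suff : #|H'| < #|H| by lia.
  by apply: proper_card; apply/properP; split;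
     [apply: subsetDl | exists x; rewrite // !inE xo].
- move=> y; rewrite !inE => /andP[yo yH]; rewrite fH // andbT.
  apply: contra yo => fyo; have po : prev (orbit f x) (f y) \in orbit f x by rewrite mem_prev.
  suff -> : y = prev (orbit f x) (f y) by [].
  apply: inj => //; first exact: orbH.
  by rewrite -(next_orb _ po) next_prev.
- by apply: sub_in2 inj => y; rewrite inE => /andP[].
- by move=> y; rewrite inE => /andP[_ /ef].
exists (orbit f x :: cs); split=> [p|].
  rewrite inE => /orP[/eqP->|/cyc_cs//]; split; last by case: (orbit f x) xo.
  apply: cycle_from_next => // y yo; rewrite next_orb //.
  by apply/ef/orbH.
apply: uniq_perm; rewrite /= ?enum_uniq //.
  rewrite cat_uniq Uorb (perm_uniq perm_cs) enum_uniq andbT /=.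
  by apply/hasPn=> y; rewrite (perm_mem perm_cs) mem_enum !inE => /andP[].
move=> y; rewrite mem_cat (perm_mem perm_cs) !mem_enum !inE.
by have [/orbH->|] := boolP (y \in orbit f x).
Qed.

(** * Counting arcs across a cut *)

Definition regular_multipartite (V : finType) (e sm : rel V) (r alpha : nat) : Prop :=
  [/\ multipartite_arcs e sm, forall v, #|[set w | e v w]| = r,
      forall v, #|[set w | e w v]| = r & forall v, #|[set w | sm v w]| = alpha].

Lemma regular_converse (V : finType) (e sm : rel V) r alpha :
  regular_multipartite e sm r alpha -> regular_multipartite (converse e) sm r alpha.
Proof. by case=> multi ? ? ?; split=> //; apply: multipartite_converse. Qed.

Definition pairs (V : finType) (R : rel V) (X Y : {set V}) : nat :=
  \sum_(u in X) \sum_(v in Y) R u v.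

Lemma sum_rel_card (V : finType) (R : rel V) (Y : {set V}) u :
  \sum_(v in Y) R u v = #|[set v in Y | R u v]|.
Proof.
rewrite -sum1_card big_mkcond [RHS]big_mkcond; apply: eq_bigr => v _.
by rewrite inE; case: (v \in Y); case: (R u v).
Qed.

Lemma pairs_converse (V : finType) (R : rel V) (X Y : {set V}) :
  pairs (converse R) X Y = pairs R Y X.
Proof. exact: exchange_big. Qed.

Lemma pairs_split (V : finType) (R : rel V) (X Y H : {set V}) :
  pairs R X H = pairs R X (H :&: Y) + pairs R X (H :\: Y).
Proof. by rewrite /pairs -big_split; apply: eq_bigr => u _; apply: big_setID. Qed.

Lemma pairs_split3 (V : finType) (R : rel V) (Y H : {set V}) : Y \subset H ->
  pairs R Y setT = pairs R Y Y + pairs R Y (H :\: Y) + pairs R Y (~: H).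
Proof.
move=> sYH; rewrite (pairs_split R Y H) setTI setTD; congr (_ + _).
by rewrite (pairs_split R Y Y) (setIidPr sYH).
Qed.

Section Counting.

Variables (V : finType) (e sm : rel V) (r alpha : nat).
Hypothesis reg : regular_multipartite e sm r alpha.

Let multi : multipartite_arcs e sm. Proof. by case: reg. Qed.

(** The identity from which all degree counts below are derived. *)
Lemma one_relation u v : e u v + e v u + sm u v = 1.
Proof.
have [suv|nsuv] := boolP (sm u v).
  have [_ ind _] := multi.
  have svu : sm v u by rewrite (sm_sym multi).
  by rewrite (negbTE (ind _ _ suv)) (negbTE (ind _ _ svu)).
by have [_ _ /(_ _ _ nsuv)] := multi; case: (e u v); case: (e v u).
Qed.

Lemma pairs_out Y : pairs e Y setT = r * #|Y|.
Proof.
rewrite mulnC -sum_nat_const; apply: eq_bigr => u _; rewrite sum_rel_card.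
by case: reg => _ out _ _; rewrite -(out u); apply: eq_card => v; rewrite !inE.
Qed.

Lemma pairs_mates Y : pairs sm Y setT = alpha * #|Y|.
Proof.
rewrite mulnC -sum_nat_const; apply: eq_bigr => u _; rewrite sum_rel_card.
by case: reg => _ _ _ cls; rewrite -(cls u); apply: eq_card => v; rewrite !inE.
Qed.

Lemma pairs_inner Y : 2 * pairs e Y Y + pairs sm Y Y = #|Y| ^ 2.
Proof.
rewrite mul2n -addnn -{2}pairs_converse -!big_split /= -mulnn -sum_nat_const.
apply: eq_bigr => u _; rewrite -!big_split /= -sum1_card.
by apply: eq_bigr => v _; rewrite one_relation.
Qed.

Lemma pairs_outer X Y : pairs e X Y + pairs sm X Y <= #|X| * #|Y|.
Proof.
rewrite -big_split /= -sum_nat_const; apply: leq_sum => u _.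
rewrite -big_split /= -sum1_card; apply: leq_sum => v _.
by have := one_relation u v; lia.
Qed.

(** Summing over the common class of [u] and [v] counts each pair [alpha] times, as
    every class has [alpha] elements.  This replaces sums over the partite sets. *)
Lemma pairs_mates_square X Y :
  alpha * pairs sm X Y =
  \sum_w (\sum_(u in X) sm w u) * (\sum_(v in Y) sm w v).
Proof.
transitivity (\sum_w \sum_(u in X) \sum_(v in Y) sm w u * sm w v); last first.
  apply: eq_bigr => w _; rewrite big_distrl; apply: eq_bigr => u _.
  by rewrite big_distrr.
rewrite exchange_big big_distrr; apply: eq_bigr => u _ /=.
rewrite exchange_big big_distrr; apply: eq_bigr => v _ /=.
have [suv|nsuv] := boolP (sm u v); last first.
  rewrite muln0 big1 // => w _; apply/eqP; rewrite muln_eq0 !eqb0 -negb_and.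
  apply: contra nsuv => /andP[wu]; apply: (sm_trans multi).
  by rewrite (sm_sym multi).
case: reg => _ _ _ cls; rewrite muln1 -(cls u) -sum1_card big_mkcond.
apply: eq_bigr => w _; rewrite inE (sm_sym multi w u).
have [suw|//] := boolP (sm u w); rewrite mul1n.
by rewrite (sm_trans multi (y := u)) // (sm_sym multi).
Qed.

Hypothesis alpha_gt0 : 0 < alpha.

(** With [X_i] and [Y_i] the sizes of the intersections with the partite sets, this
    is the sum of the inequalities [2 (a X_i) (b Y_i) <= (a X_i)^2 + (b Y_i)^2]. *)
Lemma pairs_mates_cauchy (a b : nat) X Y :
  2 * (a * b * pairs sm X Y) <= a ^ 2 * pairs sm X X + b ^ 2 * pairs sm Y Y.
Proof.
rewrite -(leq_pmul2l alpha_gt0).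
have -> : alpha * (2 * (a * b * pairs sm X Y)) = 2 * (a * b * (alpha * pairs sm X Y)).
  by lia.
have -> : alpha * (a ^ 2 * pairs sm X X + b ^ 2 * pairs sm Y Y)
    = a ^ 2 * (alpha * pairs sm X X) + b ^ 2 * (alpha * pairs sm Y Y) by lia.
rewrite !pairs_mates_square !big_distrr -big_split /=; apply: leq_sum => w _.
by rewrite mulnACA !mulnn -!expnMn; apply: nat_Cauchy.
Qed.

(** Here [MYY], [MYX], [MYW] count pairs in a common partite set and [EYY], [EYX],
    [EYW] count arcs, from [Y] to [Y], to the rest of [H] and to the complement of [H];
    [MHH] counts the pairs within [H].  Eliminating the arcs and [MYY] leaves a bound that
    increases with [MYY + MYX], for which [alpha * y] is available. *)
Lemma cut_bound_arith m y w MYY MYX MYW EYY EYX EYW MHH :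
    r * y = EYY + EYX + EYW -> 2 * EYY + MYY = y ^ 2 -> EYX <= MYX ->
    EYW + MYW <= y * w -> MYY + MYX + MYW = alpha * y ->
    2 * (m * y * (MYY + MYX)) <= m ^ 2 * MYY + y ^ 2 * MHH ->
    MHH <= alpha * m -> 0 < y -> 2 * y <= m ->
  2 * r * m + 3 * alpha * y <= y * m + 2 * (w + alpha) * m.
Proof.
clear; move=> E1 E2 E3 E4 E5 E6 E7 y0 ym.
set S := MYY + MYX in E6.
have m0 : 0 < m by lia.
have A1 : 2 * (r * y) + 3 * MYY + 2 * (alpha * y) <= y ^ 2 + 4 * S + 2 * (y * w) by lia.
have A2 : 2 * (y * S) <= m * MYY + alpha * y ^ 2.
  rewrite -(leq_pmul2l m0).
  have : y ^ 2 * MHH <= y ^ 2 * (alpha * m) by rewrite leq_mul2l E7 orbT.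
  rewrite -!mulnn in E6 *; nia.
have A3 : S <= alpha * y by lia.
have A4 : S * (4 * m - 6 * y) <= alpha * y * (4 * m - 6 * y) by rewrite leq_mul2r A3 orbT.
rewrite -(leq_pmul2l y0).
have A5 : m * (2 * (r * y) + 3 * MYY + 2 * (alpha * y)) <= m * (y ^ 2 + 4 * S + 2 * (y * w)).
  by rewrite leq_mul2l A1 orbT.
rewrite !mulnBr in A4.
have A6 : S * (6 * y) <= S * (4 * m) by rewrite leq_mul2l; lia.
have A7 : alpha * y * (6 * y) <= alpha * y * (4 * m) by rewrite leq_mul2l; lia.
rewrite -!mulnn in A5 A2 *.
nia.
Qed.

(** The out-degrees in [Y] add up to [r * #|Y|].  Inside [Y], and towards the
    complement of [H], vertices of a common partite set reduce the number of arcs;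
    towards the rest of [H] there are few arcs by hypothesis. *)
Lemma cut_bound (H Y : {set V}) :
    Y \subset H -> pairs e Y (H :\: Y) <= pairs sm Y (H :\: Y) ->
    0 < #|Y| -> 2 * #|Y| <= #|H| ->
  2 * r * #|H| + 3 * alpha * #|Y| <=
    #|Y| * #|H| + 2 * (#|~: H| + alpha) * #|H|.
Proof.
move=> sYH back Y0 YH; have := pairs_mates_cauchy #|H| #|Y| Y H.
have -> : pairs sm Y H = pairs sm Y Y + pairs sm Y (H :\: Y).
  by rewrite (pairs_split sm Y Y) (setIidPr sYH).
have E1 := pairs_out Y; have E5 := pairs_mates Y.
rewrite (pairs_split3 _ sYH) in E1; rewrite (pairs_split3 _ sYH) in E5.
have E7 : pairs sm H H <= alpha * #|H|.
  by rewrite -pairs_mates (pairs_split3 _ (subxx H)) -addnA leq_addr.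
move=> E6; apply: (cut_bound_arith (esym E1) (pairs_inner Y) back _ E5 E6 E7 Y0 YH).
exact: pairs_outer.
Qed.

End Counting.

(** With [w = alpha] the bound contradicts [2 * r >= 6 * alpha].  With
    [w = alpha + 1], put [r = 3 * alpha + d] and [y = r - 1 - f]; the bound becomes
    [3 alpha^2 + 7 alpha d + 2 d^2 + f (3 alpha + 2 d) + 1 <= 8 alpha + 3 d + f],
    whose only solution with [alpha >= 2] has [alpha = 2] and [d = f = 0]. *)
Lemma cut_bound_fails c alpha r m w y :
    6 < c -> 1 < alpha -> 2 * r + alpha = c * alpha -> m + w = 2 * r + alpha ->
    alpha <= w <= alpha.+1 -> 0 < y -> 2 * y <= m ->
    2 * r * m + 3 * alpha * y <= y * m + 2 * (w + alpha) * m ->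
  [/\ alpha = 2, r = 6, w = 3 & y = 5].
Proof.
move=> c7 a2 rE mE wE y0 ym B.
have r3 : 3 * alpha <= r by nia.
have [wa|wa] : w = alpha \/ w = alpha.+1 by lia.
  exfalso; have {}mE : m = 2 * r by lia.
  subst w m; have yr : y <= r by lia.
  have : (r - y) * (2 * r - 3 * alpha) >= 0 by [].
  nia.
have [f yf] : exists f, y + 1 + f = r by exists (r - 1 - y); lia.
have [d rd] : exists d, r = 3 * alpha + d by exists (r - 3 * alpha); lia.
have mE2 : m + 1 = 2 * r by lia.
have Ea : (y + 1 + f) * alpha = (3 * alpha + d) * alpha by rewrite yf rd.
have Ed : (y + 1 + f) * d = (3 * alpha + d) * d by rewrite yf rd.
have key : 3 * alpha * alpha + 1 + 7 * alpha * d + 2 * d * d + f * (3 * alpha + 2 * d)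
    <= 8 * alpha + 3 * d + f.
  have mE3 : m + 1 = 6 * alpha + 2 * d by lia.
  have Em_y : y * (m + 1) = y * (6 * alpha + 2 * d) by rewrite mE3.
  have Em_a : alpha * (m + 1) = alpha * (6 * alpha + 2 * d) by rewrite mE3.
  have Em_d : d * (m + 1) = d * (6 * alpha + 2 * d) by rewrite mE3.
  by clear c7 rE wE ym mE2 mE; subst w; rewrite rd in B yf; lia.
have P1 : 2 * d <= alpha * d by rewrite leq_mul2r a2 orbT.
have P2 : 2 * f <= f * alpha by rewrite mulnC leq_mul2l a2 orbT.
have P3 : 2 * alpha <= alpha * alpha by rewrite leq_mul2r a2 orbT.
have a3 : alpha = 2.
  have [//|a3] : alpha = 2 \/ 3 <= alpha by lia.
  have P4 : 3 * alpha <= alpha * alpha by rewrite leq_mul2r a3 orbT.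
  by clear -key P1 P2 P4 a3; lia.
have [d0 f0] : d = 0 /\ f = 0 by clear -key P1 P2 a3; subst alpha; lia.
by split; lia.
Qed.

(** A tournament without cyclic triples is transitive. *)
Lemma tournament_source (T : eqType) (D : T -> T -> Prop) (s : seq T) :
    uniq s -> s != [::] ->
    {in s &, forall p q, p != q -> D p q \/ D q p} ->
    (forall p q t, p \in s -> q \in s -> t \in s -> uniq [:: p; q; t] ->
       D p q -> D q t -> D t p -> False) ->
  exists2 p, p \in s & {in s, forall q, q != p -> D p q}.
Proof.
elim: s => // n s IHs /= /andP[ns Us] _ tot tri.
have [->|s0] := eqVneq s [::].
  by exists n; rewrite ?inE // => q; rewrite inE => /eqP->; rewrite eqxx.
have [||p ps src] := IHs Us s0.
- by move=> p q ps qs; apply: tot; rewrite inE ?ps ?qs orbT.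
- by move=> p q t ps qs ts; apply: tri; rewrite inE ?ps ?qs ?ts orbT.
have pn : p != n by apply: contraNneq ns => <-.
have nS : n \in n :: s by apply: mem_head.
have sS q : q \in s -> q \in n :: s by rewrite inE orbC => ->.
have [Dpn|Dnp] := tot p n (sS p ps) nS pn.
  exists p; first exact: sS.
  by move=> q; rewrite inE => /orP[/eqP->//|]; apply: src.
exists n => // q; rewrite inE => /orP[/eqP->|qs qn]; first by rewrite eqxx.
have [->//|qp] := eqVneq q p.
have nq : n != q by rewrite eq_sym.
have [//|Dqn] := tot n q nS (sS q qs) nq.
case: (tri n p q nS (sS p ps) (sS q qs) _ Dnp (src q qs qp) Dqn).
by rewrite /= !inE negb_or (eq_sym n p) pn nq (eq_sym p q) qp.
Qed.

Lemma sum_next (T : eqType) (p : seq T) (F : T -> nat) : uniq p ->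
  \sum_(k <- p) F (next p k) = \sum_(k <- p) F k.
Proof.
move=> Up; rewrite -(big_map (next p) predT F); apply: perm_big.
apply: uniq_perm => //; first by rewrite (map_inj_uniq (can_inj (prev_next Up))).
move=> x; apply/mapP/idP=> [[y yp ->]|xp]; first by rewrite mem_next.
by exists (prev p x); rewrite ?mem_prev // next_prev.
Qed.

Lemma sum_prev (T : eqType) (p : seq T) (F : T -> nat) : uniq p ->
  \sum_(k <- p) F (prev p k) = \sum_(k <- p) F k.
Proof.
move=> Up; rewrite -[LHS]sum_next //.
by apply: eq_bigr => k _; rewrite prev_next.
Qed.

(** * Hamiltonian cycles of nearly regular digraphs *)

Lemma sum_seq_set (V : finType) (p : seq V) (F : V -> nat) : uniq p ->
  \sum_(v in [set v in p]) F v = \sum_(v <- p) F v.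
Proof.
by move=> Up; rewrite big_uniq //=; apply: eq_bigl => v; rewrite inE.
Qed.

Section Factor.

Variables (V : finType) (e sm : rel V) (r alpha : nat) (H : {set V}).
Hypothesis reg : regular_multipartite e sm r alpha.
Hypothesis alpha_gt1 : 1 < alpha.
Hypothesis r_ge : 3 * alpha <= r.
Hypothesis card_H : #|H| + #|~: H| = 2 * r + alpha.
Hypothesis card_W : alpha <= #|~: H| <= alpha.+1.

Let multi : multipartite_arcs e sm. Proof. by case: reg. Qed.

(** A violation of Hall's condition provides sets [X] and [P] without arcs from [X]
    to [P] and with more than [#|H|] elements together.  Vertices in both sets are
    pairwise non-adjacent, so there are at most [alpha] of them; hence [X] and [P]
    nearly fill [H], and the vertices of [X :\: P] have too few out-neighbours.  The roles of [X] and [P] are exchanged by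
    passing to the converse digraph. *)
Lemma no_small_obstruction (X P : {set V}) :
    X \subset H -> P \subset H -> {in X & P, forall u v, ~~ e u v} ->
  #|X| <= #|P| -> #|X| + #|P| <= #|H|.
Proof.
move=> sXH sPH noarc leXP; rewrite leqNgt; apply/negP=> big.
have iota_le : #|X :&: P| <= alpha.
  have [->|[u uI]] := set_0Vmem (X :&: P); first by rewrite cards0; lia.
  case: reg => _ _ _ cls; rewrite -(cls u); apply: subset_leq_card.
  apply/subsetP=> v vI; rewrite inE; apply/negPn/negP=> nsm.
  move: uI vI; rewrite !inE => /andP[uX uP] /andP[vX vP].
  have /negP[] := noarc u v uX vP; apply: (arc_total multi) => //.
  exact: noarc.
have sUH : #|X :|: P| <= #|H| by apply: subset_leq_card; rewrite subUset sXH.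
have cU := cardsUI X P.
have leX : #|X| <= #|H| by apply: subset_leq_card.
have leP : #|P| <= #|H| by apply: subset_leq_card.
have out_le u (Q : {set V}) : {in Q, forall v, ~~ e u v} -> r <= #|~: Q|.
  move=> noQ; case: reg => _ out _ _; rewrite -(out u); apply: subset_leq_card.
  by apply/subsetP=> v; rewrite !inE => uv; apply: contraL uv => /noQ.
have cP := cardsC P; have cH := cardsC H.
have [A0|] := eqVneq (X :\: P) set0.
  have sXP : X \subset P by rewrite -setD_eq0 A0.
  have [X0|[u uX]] := set_0Vmem X; first by move: big; rewrite X0 cards0; lia.
  have := out_le u P (fun v vP => noarc u v uX vP).
  move: iota_le; rewrite (setIidPl sXP); lia.
set A := X :\: P; rewrite -card_gt0 => A_gt0.
have sAU : A \subset A :|: P by apply: subsetUl.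
have AU : (A :|: P) :\: A = P.
  apply/setP=> v; rewrite !inE; case: (v \in P); case: (v \in X) => //.
have := pairs_split3 e sAU; rewrite AU (pairs_out reg).
have -> : pairs e A P = 0.
  rewrite /pairs big1 // => u; rewrite inE => /andP[_ uX].
  by rewrite big1 // => v vP; rewrite (negbTE (noarc _ _ uX vP)).
have := pairs_outer reg A (~: (A :|: P)); have := pairs_inner reg A.
have : #|A| <= pairs sm A A.
  rewrite /pairs -sum1_card; apply: leq_sum => u uA.
  by rewrite (bigD1 u) //= (smxx multi).
have cA : #|A| + #|X :&: P| = #|X| by rewrite addnC cardsID.
have cUA : #|A :|: P| = #|A| + #|P|.
  have : A :&: P = set0.
    by apply/setP=> v; rewrite !inE; case: (v \in P); rewrite ?andbF.
  by rewrite cardsU => ->; rewrite cards0 subn0.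
have sUH' : #|A :|: P| <= #|H|.
  by apply: subset_leq_card; rewrite subUset sPH (subset_trans _ sXH) ?subsetDl.
have cAU := cardsC (A :|: P).
move=> B1 B2 B3 B4.
have B5 : #|A| * (2 * r + 1) <= #|A| * (#|A| + 2 * #|~: (A :|: P)|).
  by move: B1 B2 B3 B4; rewrite -!mulnn; clear; lia.
move: B5; rewrite leq_pmul2l //.
clear -big iota_le cU leX leP cP cH cA cUA sUH' cAU card_H card_W leXP r_ge; lia.
Qed.

End Factor.

Section Hamilton.

Variables (V : finType) (e sm : rel V) (r alpha c : nat) (H : {set V}).
Hypothesis reg : regular_multipartite e sm r alpha.
Hypothesis alpha_gt1 : 1 < alpha.
Hypothesis c_ge7 : 6 < c.
Hypothesis rE : 2 * r + alpha = c * alpha.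
Hypothesis card_H : #|H| + #|~: H| = 2 * r + alpha.
Hypothesis card_W : alpha <= #|~: H| <= alpha.+1.

Let multi : multipartite_arcs e sm. Proof. by case: reg. Qed.

Let r_ge : 3 * alpha <= r.
Proof.
have : 7 * alpha <= c * alpha by rewrite leq_mul2r c_ge7 orbT.
by rewrite -rE; lia.
Qed.

Lemma cycle_cover_exists : exists cs, cycle_cover e H cs.
Proof.
pose R u v := e u v && (v \in H).
have [X sXH|f [inj Rf]] := @hall_marriage V R H; last first.
  apply: (@injection_cycle_cover _ e H f) => // x xH; have /andP[] := Rf x xH => //.
have sN : nbhd R X \subset H by apply/subsetP=> y /nbhdP[x _ /andP[]].
have noarc : {in X & H :\: nbhd R X, forall u v, ~~ e u v}.
  move=> u v uX; rewrite inE => /andP[/nbhdP nv vH]; apply/negP=> uv.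
  by apply: nv; exists u; rewrite // /R uv.
have cN : #|H :\: nbhd R X| + #|nbhd R X| = #|H|.
  by rewrite addnC -[in RHS](cardsID (nbhd R X) H) (setIidPr sN).
have sPH : H :\: nbhd R X \subset H by apply: subsetDl.
have [XP|/ltnW PX] := leqP #|X| #|H :\: nbhd R X|.
  by have := no_small_obstruction reg alpha_gt1 r_ge card_H card_W sXH sPH noarc XP; lia.
have noarc' : {in H :\: nbhd R X & X, forall u v, ~~ converse e u v}.
  by move=> u v uP vX; apply: noarc.
have := no_small_obstruction (regular_converse reg) alpha_gt1 r_ge card_H card_W sPH sXH noarc' PX.
by lia.
Qed.

Lemma cycle_cover_perm cs cs' :
  perm_eq cs cs' -> cycle_cover e H cs -> cycle_cover e H cs'.
Proof.
move=> pcs [cyc pe]; split=> [p|]; first by rewrite -(perm_mem pcs); apply: cyc.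
by rewrite (perm_trans _ pe) // perm_sym; apply: perm_flatten.
Qed.

Lemma cover_uniq cs : cycle_cover e H cs -> uniq (flatten cs).
Proof. by case=> _ pe; rewrite (perm_uniq pe) enum_uniq. Qed.

Lemma cover_head p cs : cycle_cover e H (p :: cs) ->
  [/\ uniq p, cycle e p, p != [::] & p \notin cs].
Proof.
move=> cov; have [cyc _] := cov; have [Cp p0] := cyc p (mem_head _ _).
have := cover_uniq cov; rewrite /= cat_uniq => /and3P[Up dis _]; split=> //.
apply: contra dis => pcs; case: (p) p0 pcs => // x t _ tcs.
by apply/hasP; exists x; rewrite ?mem_head //; apply/flattenP; exists (x :: t); rewrite ?mem_head.
Qed.

Lemma cover_mem cs p : cycle_cover e H cs -> p \in cs ->
  [/\ uniq p, cycle e p, p != [::] & {subset p <= H}].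
Proof.
move=> cov pcs; have [_ pe] := cov; have pp := perm_to_rem pcs.
have [Up Cp p0 _] := cover_head (cycle_cover_perm pp cov); split=> // x xp.
by rewrite -mem_enum -(perm_mem pe); apply/flattenP; exists p.
Qed.

Lemma cover_uniq_cycles cs : cycle_cover e H cs -> uniq cs.
Proof.
move=> cov; apply: count_mem_uniq => p.
have [pcs|pcs] := boolP (p \in cs); last by apply/count_memPn.
have pp := perm_to_rem pcs; move/permP: (pp) => -> /=; rewrite eqxx.
by have [_ _ _ /count_memPn ->] := cover_head (cycle_cover_perm pp cov).
Qed.

Lemma perm_to_rem2 (T : eqType) (cs : seq T) p q :
  p \in cs -> q \in cs -> p != q -> perm_eq cs (p :: q :: rem q (rem p cs)).
Proof.
move=> pcs qcs pq; apply: perm_trans (perm_to_rem pcs) _; rewrite perm_cons.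
apply: perm_to_rem; move: qcs; rewrite (perm_mem (perm_to_rem pcs)) inE.
by rewrite eq_sym (negbTE pq).
Qed.

Lemma cover_merge l q rest : l != [::] -> cycle e q -> perm_eq q (flatten l) ->
  cycle_cover e H (l ++ rest) -> cycle_cover e H (q :: rest).
Proof.
move=> l0 Cq pq [cyc pe]; split=> [p|].
  rewrite inE => /orP[/eqP->|prest]; last by apply: cyc; rewrite mem_cat prest orbT.
  split=> //; case: l l0 pq cyc {pe} => // p1 l _ pq cyc.
  have [_] := cyc p1 (mem_head _ _); apply: contraNneq => q0.
  by move: (perm_size pq); rewrite q0 /= size_cat; case: (p1).
by rewrite (perm_trans _ pe) // flatten_cat /= perm_cat2r.
Qed.

Section Minimal.

Variable cs : seq (seq V).
Hypothesis cov : cycle_cover e H cs.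
Hypothesis minimal : forall cs', cycle_cover e H cs' -> size cs <= size cs'.

Lemma minimal_unmergeable p q :
  p \in cs -> q \in cs -> p != q -> unmergeable e p q.
Proof.
move=> pcs qcs pq; have pp := perm_to_rem2 pcs qcs pq.
have cov' := cycle_cover_perm pp cov.
have [_ Cp _ _] := cover_mem cov pcs; have [_ Cq _ _] := cover_mem cov qcs.
split=> //.
  by move: (cover_uniq cov'); rewrite /= catA cat_uniq => /andP[].
case=> t Ct pt; have := @cover_merge [:: p; q] t _ isT Ct _ cov'.
by rewrite /= cats0 => /(_ pt) /minimal; rewrite (perm_size pp) /= ltnn.
Qed.

Lemma minimal_no_triangle p q t :
    p \in cs -> q \in cs -> t \in cs -> uniq [:: p; q; t] ->
  dominates e sm p q -> dominates e sm q t -> dominates e sm t p -> False.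
Proof.
move=> pcs qcs tcs; rewrite /= !inE negb_or andbT => /andP[/andP[pq pt] qt] d1 d2 d3.
have [Up Cp p0 _] := cover_mem cov pcs; have [Uq Cq q0 _] := cover_mem cov qcs.
have [Ut Ct t0 _] := cover_mem cov tcs.
have [s Cs ps] := dominance_triangle_merges multi Up Uq Ut Cp Cq Ct p0 q0 t0 d1 d2 d3.
have pp := perm_to_rem2 pcs qcs pq; set rest := rem q _ in pp.
have trest : t \in rest.
  by move: tcs; rewrite (perm_mem pp) !inE !(eq_sym t) (negbTE pt) (negbTE qt).
have pp' : perm_eq cs ([:: p; q; t] ++ rem t rest).
  by apply: perm_trans pp _; rewrite !perm_cons perm_to_rem.
have cov' := cycle_cover_perm pp' cov.
have := @cover_merge [:: p; q; t] s _ isT Cs _ cov'.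
rewrite /= cats0 => /(_ ps) /minimal; rewrite (perm_size pp') /=.
by clear; lia.
Qed.

(** A back arc from [k] to [s] is charged to the pair formed by the successor of [k]
    and the predecessor of [s], which lie in a common partite set.  Both maps are
    bijections, so no pair is charged twice. *)
Lemma source_back_pairs p : p \in cs ->
    {in cs, forall q, q != p -> dominates e sm p q} ->
  pairs e (H :\: [set v in p]) [set v in p]
    <= pairs sm (H :\: [set v in p]) [set v in p].
Proof.
move=> pcs src; set X := [set v in p]; have [Up Cp p0 _] := cover_mem cov pcs.
have pp := perm_to_rem pcs; have cov' := cycle_cover_perm pp cov.
have sumY (F : V -> nat) : \sum_(k in H :\: X) F k = \sum_(q <- rem p cs) \sum_(k <- q) F k.
  rewrite -big_flatten /=; transitivity (\sum_(k in flatten (rem p cs)) F k); last first.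
    by rewrite big_uniq //; have := cover_uniq cov'; rewrite /= cat_uniq => /and3P[].
  apply: eq_bigl => k; rewrite !inE; have [_ pe'] := cov'.
  rewrite -(mem_enum H) -(perm_mem pe') /= mem_cat; case: (boolP (k \in p)) => //= kp.
  by have := cover_uniq cov'; rewrite /= cat_uniq => /and3P[_ /hasPn/(_ k)]; case: (k \in _) => // /(_ isT)/negP.
rewrite -!(pairs_converse _ X) /pairs !sum_seq_set //.
rewrite -[leqRHS]sum_prev // [leqLHS]big_seq [leqRHS]big_seq.
apply: leq_sum => s sp; rewrite !sumY [leqLHS]big_seq [leqRHS]big_seq.
apply: leq_sum => q qrem; have qcs : q \in cs by apply: mem_rem qrem.
have qp : q != p.
  by apply: contraTneq qrem => ->; have [_ _ _] := cover_head cov'.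
have [Uq _ _ _] := cover_mem cov qcs.
rewrite -[leqRHS]sum_next // [leqLHS]big_seq [leqRHS]big_seq.
apply: leq_sum => k kq; rewrite /converse.
by have := src q qcs qp s k sp kq; case: (e k s) => // ->.
Qed.

End Minimal.

Lemma pairs_mates_sym (X Y : {set V}) : pairs sm X Y = pairs sm Y X.
Proof.
rewrite -pairs_converse; apply: eq_bigr => u _; apply: eq_bigr => v _.
by rewrite /converse (sm_sym multi).
Qed.

Lemma cut_sizes (X : {set V}) :
    X \subset H -> X != set0 -> H :\: X != set0 ->
    pairs e (H :\: X) X <= pairs sm (H :\: X) X ->
  [/\ alpha = 2, r = 6, #|~: H| = 3 & #|X| = 5 \/ #|H :\: X| = 5].
Proof.
rewrite -!card_gt0 => sXH X0 Y0 back; have a0 : 0 < alpha by apply: ltnW.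
have cH : #|X| + #|H :\: X| = #|H| by rewrite -[RHS](cardsID X H) (setIidPr sXH).
have [XY|YX] := leqP #|X| #|H :\: X|.
  have back' : pairs (converse e) X (H :\: X) <= pairs sm X (H :\: X).
    by rewrite pairs_converse pairs_mates_sym.
  have X2 : 2 * #|X| <= #|H| by lia.
  have B := cut_bound (regular_converse reg) a0 sXH back' X0 X2.
  have [-> -> -> ->] := cut_bound_fails c_ge7 alpha_gt1 rE card_H card_W X0 X2 B.
  by split=> //; left.
have YE : H :\: (H :\: X) = X by rewrite setDDr setDv set0U (setIidPr sXH).
have Y2 : 2 * #|H :\: X| <= #|H| by lia.
have sYH : H :\: X \subset H by apply: subsetDl.
rewrite -{2 4}YE in back.
have B := cut_bound reg a0 sYH back Y0 Y2.
have [-> -> -> ->] := cut_bound_fails c_ge7 alpha_gt1 rE card_H card_W Y0 Y2 B.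
by split=> //; right.
Qed.

Lemma source_sizes cs p : cycle_cover e H cs -> 1 < size cs -> p \in cs ->
    {in cs, forall q, q != p -> dominates e sm p q} ->
  [/\ alpha = 2, r = 6, #|~: H| = 3 & size p = 5 \/ size p = 6].
Proof.
move=> cov cs2 pcs src; have [Up Cp p0 pH] := cover_mem cov pcs.
set X := [set v in p]; have cX : #|X| = size p by rewrite cardsE; apply/card_uniqP.
have sXH : X \subset H by apply/subsetP=> v; rewrite inE; apply: pH.
have X0 : X != set0 by rewrite -card_gt0 cX lt0n size_eq0.
have cH : #|X| + #|H :\: X| = #|H| by rewrite -[RHS](cardsID X H) (setIidPr sXH).
have Y0 : H :\: X != set0.
  have pp := perm_to_rem pcs; have cov' := cycle_cover_perm pp cov.
  have [_ pe'] := cov'; have := cover_uniq cov'.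
  have : 0 < size (rem p cs) by rewrite size_rem //; case: (size cs) cs2 => // -[].
  case E : (rem p cs) => [//|q rest] _; rewrite /= cat_uniq => /and3P[_ dis _].
  have [_ _ q0 _] : [/\ uniq q, cycle e q, q != [::] & {subset q <= H}].
    by apply: cover_mem cov _; apply: (mem_rem (x := p)); rewrite E mem_head.
  case: q q0 E dis pe' => // y q _ E dis pe'; apply/set0Pn; exists y.
  rewrite !inE -(mem_enum H) -(perm_mem pe') E /= mem_cat inE eqxx orbT andbT.
  by apply: (hasPn dis); rewrite /= inE eqxx.
have [? ? W3 sizes] := cut_sizes sXH X0 Y0 (source_back_pairs cov pcs src).
split=> //; move: card_H; rewrite W3; case: sizes; lia.
Qed.

(** The case that the count leaves open, with five vertices on [q] and six on [p].
    The degrees force at least five back arcs, and each vertex of [q] has at most one,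
    as its successor has a single other vertex in its partite set.  So all vertices of
    [q] have one, in particular two consecutive ones. *)
Lemma balanced_pair_merges p q :
    alpha = 2 -> r = 6 -> #|~: H| = 3 -> cycle_cover e H [:: p; q] ->
    unmergeable e p q -> dominates e sm p q -> size q <> 5.
Proof.
move=> a2 r6 W3 cov U dom sq; have [Up Uq] := unmergeable_uniq U.
have [Upq Cp Cq _] := U.
have [_ _ q0 qH] : [/\ uniq q, cycle e q, q != [::] & {subset q <= H}].
  by apply: cover_mem cov _; rewrite !inE eqxx orbT.
set Y := [set v in q]; have cY : #|Y| = 5 by rewrite cardsE -sq; apply/card_uniqP.
have sYH : Y \subset H by apply/subsetP=> v; rewrite inE; apply: qH.
have XE : H :\: Y = [set v in p].
  have [_ pe] := cov; apply/setP=> v; rewrite !inE -(mem_enum H) -(perm_mem pe) /= cats0 mem_cat.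
  have [vq|vq] := boolP (v \in q); last by rewrite orbF.
  symmetry; apply/negbTE/negP=> vp; move: Upq; rewrite cat_uniq => /and3P[_ /hasPn/(_ v vq)].
  by rewrite /= vp.
have le1 k : k \in q -> \sum_(s in [set v in p]) e k s <= 1.
  move=> kq; rewrite sum_seq_set //.
  apply: (@leq_trans (\sum_(s <- p) sm (next q k) (prev p s))).
    rewrite [leqLHS]big_seq [leqRHS]big_seq; apply: leq_sum => s sp.
    by have := dom s k sp kq; case: (e k s) => // ->.
  rewrite (sum_prev (fun s => nat_of_bool (sm (next q k) s)) Up) -sum_seq_set //.
  rewrite sum_rel_card.
  case: reg => _ _ _ /(_ (next q k)); rewrite a2 => c2.
  rewrite -ltnS -c2; apply: proper_card; apply/properP; split.
    by apply/subsetP=> v; rewrite !inE => /andP[].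
  exists (next q k); rewrite !inE (smxx multi) // andbT.
  apply/negP=> np; move: Upq; rewrite cat_uniq => /and3P[_ /hasPn/(_ (next q k))].
  by rewrite mem_next kq np => /(_ isT).
have ge5 : 5 <= pairs e Y [set v in p].
  have := pairs_out reg Y; rewrite (pairs_split3 _ sYH) XE cY r6.
  have := pairs_inner reg Y; have := pairs_outer reg Y (~: H); rewrite W3 cY.
  have : #|Y| <= pairs sm Y Y.
    rewrite /pairs -sum1_card; apply: leq_sum => u uA.
    by rewrite (bigD1 u) //= (smxx multi).
  rewrite cY; clear; lia.
have sends k : k \in q -> exists2 s, s \in p & e k s.
  move=> kq; suff : 0 < \sum_(s in [set v in p]) e k s.
    rewrite sum_rel_card => /card_gt0P[s]; rewrite !inE => /andP[sp ks].
    by exists s.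
  have kY : k \in Y by rewrite inE.
  move: ge5; rewrite /pairs (big_setD1 k kY) /=.
  have : \sum_(i in Y :\ k) \sum_(s in [set v in p]) e i s <= 4.
    have c4 : #|Y :\ k| = 4 by move: cY; rewrite (cardsD1 k) kY => -[].
    rewrite -[leqRHS]c4 -sum1_card; apply: leq_sum => i.
    by rewrite !inE => /andP[_ iq]; apply: le1.
  move=> le4 ge5'; rewrite lt0n; apply/negP=> /eqP k0.
  by move: ge5'; rewrite k0 add0n => /leq_trans/(_ le4).
have [k kq] : exists k, k \in q by case: (q) q0 => // y t _; exists y; apply: mem_head.
have [a ap ka] := sends k kq.
have nkq : next q k \in q by rewrite mem_next.
have [f fp nkf] := sends _ nkq.
by have := no_consecutive_back_arcs multi U dom kq ap ka fp; rewrite nkf.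
Qed.

End Hamilton.

Lemma cover_converse (V : finType) (e : rel V) (H : {set V}) cs :
  cycle_cover e H cs -> cycle_cover (converse e) H (map rev cs).
Proof.
case=> cyc pe; split=> [_ /mapP[p pcs ->]|].
  have [Cp p0] := cyc p pcs; rewrite cycle_rev; split=> //.
  by rewrite -size_eq0 size_rev size_eq0.
apply: perm_trans pe; elim: cs {cyc} => //= p cs IHcs.
by rewrite perm_cat // perm_rev.
Qed.

(** Consider a minimal cover with at least two cycles.  One of them dominates all
    others and, by the same argument, one is dominated by all others.  The cut at
    either leaves only the sizes 5 and 6 within eleven vertices; so there are exactly
    two cycles, and [balanced_pair_merges] applies to them or to their converses. *)
Theorem near_regular_hamiltonian (V : finType) (e sm : rel V) r alpha c (H : {set V}) :
    regular_multipartite e sm r alpha -> 1 < alpha -> 6 < c ->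
    2 * r + alpha = c * alpha -> #|H| + #|~: H| = 2 * r + alpha ->
    alpha <= #|~: H| <= alpha.+1 ->
  exists2 p, cycle e p & perm_eq p (enum H).
Proof.
move=> reg a2 c7 rE cH cW; have [multi _ _ _] := reg.
have reg' := regular_converse reg.
suff /hasP[p] : has (cycle e) (permutations (enum H)).
  by rewrite mem_permutations => pe Cp; exists p.
apply/negPn/negP=> /hasPn nonham.
suff nocov n : forall cs, size cs < n -> ~ cycle_cover e H cs.
  have [cs cov] := cycle_cover_exists reg a2 c7 rE cH cW.
  exact: (nocov _ cs (ltnSn _) cov).
elim: n => // n IHn cs; rewrite ltnS => le_n cov.
have minimal cs' : cycle_cover e H cs' -> size cs <= size cs'.
  by move=> cov'; rewrite leqNgt; apply/negP=> lt; apply: IHn cov'; apply: leq_trans lt le_n.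
have H0 : 0 < #|H|.
  have : 7 * alpha <= c * alpha by rewrite leq_mul2r c7 orbT.
  by rewrite -rE; lia.
have cs2 : 1 < size cs.
  case: cs cov {le_n minimal} => [|p [|q cs]] // [cyc pe].
    by move: (perm_size pe); rewrite -cardE /= => E; rewrite -E in H0.
  have [Cp _] := cyc p (mem_head _ _).
  have pperm : p \in permutations (enum H) by rewrite mem_permutations -(cats0 p).
  by have := nonham p pperm; rewrite Cp.
have Ucs := cover_uniq_cycles cov.
have cs0 : cs != [::] by case: (cs) cs2.
have tot : {in cs &, forall p q, p != q -> dominates e sm p q \/ dominates e sm q p}.
  move=> p q pcs qcs pq; apply: (dominance multi).
  exact: minimal_unmergeable cov minimal _ _ pcs qcs pq.
have tri p q t := @minimal_no_triangle _ e sm r alpha H reg cs cov minimal p q t.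
have [p pcs srcp] := tournament_source Ucs cs0 tot tri.
have [q qcs srcq] : exists2 q, q \in cs & {in cs, forall t, t != q -> dominates e sm t q}.
  apply: (tournament_source (D := fun q t => dominates e sm t q) Ucs cs0) => [s t scs tcs st|s t u scs tcs ucs Ustu d1 d2 d3].
    by case: (tot s t scs tcs st) => ?; [right|left].
  apply: (tri u t s) => //; move: Ustu; rewrite /= !inE !negb_or !(eq_sym u) !(eq_sym t).
  by rewrite andbT => /andP[/andP[-> ->] ->].
have [alpha2 r6 W3 szp] := source_sizes reg a2 c7 rE cH cW cov cs2 pcs srcp.
have szq : size q = 5 \/ size q = 6.
  have cov' := cover_converse cov.
  have cs2' : 1 < size (map rev cs) by rewrite size_map.
  have src' : {in map rev cs, forall t, t != rev q -> dominates (converse e) sm (rev q) t}.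
    move=> _ /mapP[t tcs ->] tq; have [Uq _ _ _] := cover_mem cov qcs.
    have [Ut _ _ _] := cover_mem cov tcs.
    apply/(dominates_converse multi) => //; apply: srcq => //.
    by apply: contraNneq tq => ->.
  have [_ _ _] := source_sizes reg' a2 c7 rE cH cW cov' cs2' (map_f rev qcs) src'.
  by rewrite size_rev.
have H11 : #|H| = 11 by move: cH; rewrite W3 r6 alpha2; clear; lia.
have sum_sizes s t u : perm_eq cs (s :: t :: u) -> size s + size t + size (flatten u) = 11.
  move=> pe; have [_ /perm_size] := cycle_cover_perm pe cov.
  by rewrite /= !size_cat -cardE H11 addnA.
have sz3 t : t \in cs -> 2 < size t.
  by move=> tcs; have [_ Ct t0 _] := cover_mem cov tcs; apply: (cycle_size_ge3 multi).
have [t [tcs tp]] : exists t, t \in cs /\ p != t.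
  case: (cs) cs2 Ucs => [|x [|y cs']] //= _ /andP[]; rewrite inE negb_or => /andP[xy _] _.
  have [px|px] := eqVneq p x; last by exists x; rewrite !inE eqxx px.
  by exists y; rewrite !inE eqxx orbT px.
have pe := perm_to_rem2 pcs tcs tp; have szs := sum_sizes _ _ _ pe.
case E : (rem t (rem p cs)) => [|u rest] in pe szs.
  have U := minimal_unmergeable cov minimal pcs tcs tp.
  have dom : dominates e sm p t by apply: srcp; rewrite // eq_sym.
  have cov2 := cycle_cover_perm pe cov.
  have := balanced_pair_merges reg alpha2 r6 W3 cov2 U dom.
  case: szp => szp; last by move: szs; rewrite szp /=; clear; lia.
  move=> _; have U' := unmergeable_converse (unmergeableC U).
  have [Up Ut] := unmergeable_uniq U.
  have dom' : dominates (converse e) sm (rev t) (rev p) by apply/(dominates_converse multi).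
  have cov3 : cycle_cover (converse e) H [:: rev t; rev p].
    apply: cycle_cover_perm (cover_converse cov2).
    by rewrite -[map _ _]/([:: rev p] ++ [:: rev t]) perm_catC.
  by apply: (balanced_pair_merges reg' alpha2 r6 W3 cov3 U' dom'); rewrite size_rev.
have ucs : u \in cs by rewrite (perm_mem pe) !inE eqxx !orbT.
have [pu tu] : p != u /\ t != u.
  move: Ucs; rewrite (perm_uniq pe) /= !inE !negb_or.
  by case/and3P=> /and3P[_ -> _] /andP[-> _] _.
have [qp|qp] := eqVneq q p.
  (* [p] would dominate all other cycles and be dominated by all of them *)
  have dpt : dominates e sm p t by apply: srcp; rewrite // eq_sym.
  have dpu : dominates e sm p u by apply: srcp; rewrite // eq_sym.
  have dtp : dominates e sm t p by rewrite -qp; apply: srcq; rewrite // qp eq_sym.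
  have dup : dominates e sm u p by rewrite -qp; apply: srcq; rewrite // qp eq_sym.
  have [dtu|dut] := tot t u tcs ucs tu.
    by apply: (tri p t u) => //; rewrite /= !inE negb_or tp pu tu.
  by apply: (tri p u t) => //; rewrite /= !inE negb_or tp pu eq_sym tu.
have pq : p != q by rewrite eq_sym.
have pe' := perm_to_rem2 pcs qcs pq; have szs' := sum_sizes _ _ _ pe'.
have : size (rem q (rem p cs)) = (size rest).+1.
  by have := perm_size pe; rewrite (perm_size pe') /= => -[].
case E' : (rem q (rem p cs)) => [//|v rest'] in pe' szs' * => _.
have vcs : v \in cs by rewrite (perm_mem pe') !inE eqxx !orbT.
have := sz3 v vcs; move: szs'; rewrite /= size_cat.
by case: szp => ->; case: szq => ->; clear; lia.
Qed.

(** * Lengths read off a Hamiltonian cycle *)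

Lemma nth_iter_next (T : eqType) (a : T) s d : uniq (a :: s) -> d < size (a :: s) ->
  nth a (a :: s) d = iter d (next (a :: s)) a.
Proof.
move=> Us; elim: d => // d IHd lt_d; rewrite iterS -IHd ?(ltnW lt_d) //.
by rewrite next_nth mem_nth ?(ltnW lt_d) // index_uniq ?(ltnW lt_d).
Qed.

Lemma iter_next_rot (T : eqType) (p : seq T) i a s d :
  uniq p -> rot i p = a :: s -> iter d (next (a :: s)) a = iter d (next p) a.
Proof.
move=> Up ri; have [_ Ns _ _] := rot_uniq_next Up ri.
by elim: d => // d IHd; rewrite !iterS IHd Ns.
Qed.

Lemma mem_iter_next (T : eqType) (p : seq T) d a : (iter d (next p) a \in p) = (a \in p).
Proof. by elim: d => //= d; rewrite mem_next. Qed.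

Lemma cycle_segment (T : eqType) (e : rel T) p a d :
    uniq p -> cycle e p -> a \in p -> d < size p ->
  exists s, [/\ path e a s, size s = d, last a s = iter d (next p) a,
                uniq (a :: s) & {subset a :: s <= p}].
Proof.
move=> Up Cp ap lt_d; case/rot_to: (ap) => i s ri.
have [Us _ _ Ms] := rot_uniq_next Up ri.
have ss : size (a :: s) = size p by rewrite -ri size_rot.
have lt_d' : d <= size s by move: lt_d; rewrite -ss.
have std : size (take d s) = d by rewrite size_takel.
exists (take d s); split=> //.
- have : sorted e (rot i p) by apply: cycle_sorted; rewrite rot_cycle.
  by rewrite ri /= -{1}(cat_take_drop d s) cat_path => /andP[].
- rewrite -(iter_next_rot d Up ri) -nth_iter_next ?ss //.
  rewrite (last_nth a) std.
  by rewrite -[in RHS](cat_take_drop d s) -cat_cons nth_cat /= std ltnSn.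
- by rewrite -[a :: _]/(take d.+1 (a :: s)) take_uniq.
by move=> x; rewrite -[a :: _]/(take d.+1 (a :: s)) -Ms => /mem_take.
Qed.

(** Moving [d] steps along [p] is a bijection, so [A] and the preimage of [B] are too
    large to be disjoint. *)
Lemma hits_by_counting (V : finType) (p : seq V) (A B : {set V}) d :
    uniq p -> {subset A <= p} -> {subset B <= p} -> size p < #|A| + #|B| ->
  exists2 a, a \in A & iter d (next p) a \in B.
Proof.
move=> Up sA sB big; set f := iter d (next p).
have inj_f : injective f.
  by rewrite /f; elim: (d) => //= k IHk x y /(can_inj (prev_next Up)) /IHk.
have cB : #|f @^-1: B| = #|B| by apply: card_preimset.
have : A :|: f @^-1: B \subset [set v in p].
  apply/subsetP=> v; rewrite !inE => /orP[/sA//|/sB].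
  by rewrite mem_iter_next.
have cp : #|[set v in p]| = size p by rewrite cardsE; apply/card_uniqP.
move/subset_leq_card; rewrite cp => le; have := cardsUI A (f @^-1: B); rewrite cB => cUI.
have : 0 < #|A :&: f @^-1: B| by clear -big le cUI; lia.
by case/card_gt0P=> a; rewrite !inE => /andP[aA fa]; exists a.
Qed.

Lemma sum_periodic (F : nat -> nat) g k : (forall i, F (i + g) = F i) ->
  \sum_(0 <= i < k * g) F i = k * \sum_(0 <= i < g) F i.
Proof.
move=> per; elim: k => [|k IHk]; first by rewrite !mul0n big_geq.
rewrite !mulSn (@big_cat_nat _ _ _ g) //= ?leq_addr //; congr (_ + _).
rewrite -IHk -{1}[g]add0n big_addn addKn; apply: eq_bigr => i _; exact: per.
Qed.

(** [A] is invariant under the steps [d] and [size p], hence under their greatest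
    common divisor [g]; so it meets each of the [size p / g] windows of length [g] in
    equally many elements. *)
Lemma rotation_invariant_card (V : finType) (p : seq V) (A : {set V}) d :
    uniq p -> {subset A <= p} -> 0 < d -> p != [::] ->
    {in A, forall a, iter d (next p) a \in A} ->
  size p %/ gcdn d (size p) %| #|A|.
Proof.
move=> Up sA d0 p0 inv; set m := size p; set g := gcdn d m.
have [x xp] : exists x, x \in p by case: (p) p0 => // x t _; exists x; apply: mem_head.
case/rot_to: (xp) => i s ri; have [Us _ _ Ms] := rot_uniq_next Up ri.
have ss : size (x :: s) = m by rewrite -ri size_rot.
pose F j : nat := iter j (next p) x \in A.
have m0 : 0 < m by rewrite -ss.
have Fm j : F (j + m) = F j.
  rewrite /F iterD; congr (nat_of_bool (iter j _ _ \in A)).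
  have -> : m = (size s).+1 by rewrite -ss.
  rewrite iterS -(iter_next_rot _ Up ri) -nth_iter_next //.
  have [_ Ns _ _] := rot_uniq_next Up ri; rewrite -Ns.
  by rewrite next_nth mem_nth // index_uniq // nth_default.
have Fmk k j : F (j + k * m) = F j.
  by elim: k => [|k IHk]; rewrite ?mul0n ?addn0 // mulSnr addnA Fm.
have Fd_le j : F j <= F (j + d).
  rewrite /F addnC iterD; case: (boolP (iter j (next p) x \in A)) => // jA.
  by rewrite inv.
have Fdk_le k j : F j <= F (j + k * d).
  elim: k => [|k IHk]; first by rewrite mul0n addn0.
  by rewrite mulSnr addnA (leq_trans IHk).
have Fd j : F (j + d) = F j.
  apply/eqP; rewrite eqn_leq Fd_le andbT.
  have := Fdk_le m.-1 (j + d); rewrite -addnA -mulSn prednK // mulnC.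
  by rewrite Fmk.
have Fdk k j : F (j + k * d) = F j.
  by elim: k => [|k IHk]; rewrite ?mul0n ?addn0 // mulSnr addnA Fd.
have Fg j : F (j + g) = F j.
  have [u v uv _] := egcdnP m d0.
  by rewrite -(Fmk v) -addnA (addnC g) -uv Fdk.
have -> : #|A| = \sum_(0 <= j < m) F j.
  transitivity (\sum_(v <- x :: s) (v \in A)).
    rewrite big_uniq // -sum1_card big_mkcond [RHS]big_mkcond.
    apply: eq_bigr => v _; rewrite Ms.
    by have [/sA->|] := boolP (v \in A); case: (v \in p).
  rewrite (big_nth x) ss; apply: eq_big_nat => j /andP[_ jm].
  by rewrite nth_iter_next ?ss // (iter_next_rot j Up ri).
have gm : g %| m by apply: dvdn_gcdr.
rewrite -{2}(divnK gm) sum_periodic //; exact: dvdn_mulr.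
Qed.

Lemma cycle_through_arc (V : finType) (e : rel V) (x y a : V) s :
    e x y -> e y a -> path e a s -> e (last a s) x ->
    uniq [:: x, y, a & s] ->
  arc_in_cycle_of_length e x y (size s + 3).
Proof.
move=> xy ya ps sx U; exists [:: x, y, a & s]; last by rewrite /= addn3.
split; rewrite ?mem_head //=; last by rewrite eqxx.
by rewrite /ucycle U /= xy ya rcons_path ps sx.
Qed.

Lemma triangle_through_arc (V : finType) (e : rel V) (x y : V) :
  arc_in_cycle_of_length e x y 3 -> exists2 z, e y z & e z x.
Proof.
case=> p [/andP[Cp Up] xp nx] sp; case/rot_to: (xp) => i s ri.
have [_ Ns _ _] := rot_uniq_next Up ri.
have : size (x :: s) = 3 by rewrite -ri size_rot.
have : cycle e (x :: s) by rewrite -ri rot_cycle.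
move: nx; rewrite -Ns; case: s {ri Ns} => [|u [|z [|? ?]]] //=.
by rewrite eqxx => -> /and4P[_ yz zx _] _; exists z.
Qed.

Lemma distinct_lengths (V : finType) (e : rel V) (x y : V) l k :
    (forall j, l <= j < l + k -> arc_in_cycle_of_length e x y j) ->
  arc_in_cycles_of_distinct_lengths e x y k.
Proof.
move=> all_len; suff [s [cyc sz]] : exists s,
    (forall p, p \in s -> arc_in_cycle e x y p) /\ map size s = iota l k.
  exists s; split=> //; first by rewrite sz iota_uniq.
  by rewrite -(size_map size) sz size_iota.
elim: k => [|k IHk] in l all_len *; first by exists [::].
have [|s [cyc sz]] := IHk l.+1.
  by move=> j /andP[lj jk]; apply: all_len; rewrite (ltnW lj) addnS -addSn.
have [|p cp sp] := all_len l; first by rewrite leqnn addnS ltnS leq_addr.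
exists (p :: s); split=> [q|/=]; last by rewrite sz sp.
by rewrite inE => /orP[/eqP->|/cyc].
Qed.

Lemma subset_of_card (V : finType) (X Y : {set V}) n :
    X \subset Y -> #|X| <= n <= #|Y| ->
  exists Z : {set V}, [/\ X \subset Z, Z \subset Y & #|Z| = n].
Proof.
move=> sXY /andP[]; elim: n => [|n IHn] Xn nY.
  by exists X; split=> //; apply/eqP; rewrite -leqn0.
have [Xn'|Xn'] := leqP #|X| n; last by exists X; split=> //; lia.
have [Z [sXZ sZY cZ]] := IHn Xn' (ltnW nY).
have : 0 < #|Y :\: Z|.
  by have := cardsID Z Y; rewrite (setIidPr sZY); lia.
case/card_gt0P=> z; rewrite inE => /andP[zZ zY]; exists (z |: Z); split.
- exact: subset_trans sXZ (subsetUr _ _).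
- by rewrite subUset sub1set zY.
by rewrite cardsU1 zZ cZ.
Qed.

(** * Cycles through an arc *)

Definition same_part (V : finType) (P : {set {set V}}) : rel V :=
  fun u v => pblock P u == pblock P v.

Lemma tournament_regular_multipartite (V : finType) (P : {set {set V}}) (e : rel V) c alpha r :
    multipartite_tournament c P e -> (forall A : {set V}, A \in P -> #|A| = alpha) ->
    regular_digraph e r ->
  regular_multipartite e (same_part P) r alpha /\ #|V| = c * alpha.
Proof.
case=> part cP ind tot cA reg; split; last first.
  by rewrite -cardsT (card_uniform_partition cA part) cP.
have [/eqP covP tI _] := and3P part.
split=> [|v|v|v]; try by have [] := reg v.
  split=> [u v w|u v /eqP|u v /eqP]; last exact: tot.
    by rewrite /same_part eqxx; split=> // /eqP->.
  exact: ind.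
have vP : v \in cover P by rewrite covP.
rewrite -(cA (pblock P v)) ?pblock_mem //; apply: eq_card => w.
by rewrite inE /same_part eq_pblock.
Qed.

Lemma card_regular_multipartite (V : finType) (e sm : rel V) r alpha (v : V) :
  regular_multipartite e sm r alpha -> 2 * r + alpha = #|V|.
Proof.
move=> reg; have E1 := pairs_out reg [set v].
have E2 := pairs_out (regular_converse reg) [set v].
have E3 := pairs_mates reg [set v].
rewrite /pairs !big_set1 cards1 !muln1 in E1 E2 E3.
rewrite mul2n -addnn -{1}E1 -{1}E2 -E3 -!big_split /= -cardsT -sum1_card.
by apply: eq_bigr => w _; rewrite (one_relation reg).
Qed.

Section ArcCycles.

Variables (V : finType) (e sm : rel V) (r alpha c : nat) (x y : V).
Hypothesis reg : regular_multipartite e sm r alpha.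
Hypothesis alpha_gt1 : 1 < alpha.
Hypothesis c_ge7 : 6 < c.
Hypothesis card_V : #|V| = c * alpha.
Hypothesis xy : e x y.

Let multi : multipartite_arcs e sm. Proof. by case: reg. Qed.

Let A := [set a | e y a].
Let B := [set b | e b x].

Let rE : 2 * r + alpha = c * alpha.
Proof. by rewrite -card_V; apply: card_regular_multipartite x reg. Qed.

Let r_ge : 3 * alpha <= r.
Proof.
have : 7 * alpha <= c * alpha by rewrite leq_mul2r c_ge7 orbT.
by rewrite -rE; clear; lia.
Qed.

Let card_A : #|A| = r. Proof. by have [_ out _ _] := reg; apply: out. Qed.
Let card_B : #|B| = r. Proof. by have [_ _ inn _] := reg; apply: inn. Qed.

Let off_arc v : v \in A :|: B -> v \notin [set x; y].
Proof.
have yx : e y x = false by apply/negbTE/(arc_asym multi).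
rewrite !inE => vAB; apply/norP; split; apply/eqP=> E; move: vAB; rewrite E.
  by rewrite yx (negbTE (arc_irr multi x)).
by rewrite yx (negbTE (arc_irr multi y)).
Qed.

Lemma cycle_from_hamiltonian (H : {set V}) p a d :
    cycle e p -> perm_eq p (enum H) -> [disjoint H & [set x; y]] ->
    d < #|H| -> a \in A -> a \in H -> iter d (next p) a \in B ->
  arc_in_cycle_of_length e x y (d + 3).
Proof.
move=> Cp pe dis lt_d; rewrite !inE => ya aH bx.
have Up : uniq p by rewrite (perm_uniq pe) enum_uniq.
have pH v : v \in p -> v \in H by rewrite (perm_mem pe) mem_enum.
have ap : a \in p by rewrite (perm_mem pe) mem_enum.
have lt_dp : d < size p by rewrite (perm_size pe) -cardE.
have [s [ps ss ls Us sub]] := cycle_segment Up Cp ap lt_dp.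
rewrite -ss; apply: (cycle_through_arc xy ya ps); first by rewrite ls.
have nin v : v \in [set x; y] -> v \notin a :: s.
  by move=> vxy; apply/negP=> /sub /pH vH; move: (disjointFr dis vH); rewrite vxy.
rewrite -[uniq _]/[&& x \notin y :: (a :: s), y \notin a :: s & uniq (a :: s)].
rewrite Us nin ?inE ?eqxx ?orbT // negb_or (nin x) ?inE ?eqxx // !andbT.
by apply/eqP=> E; move: xy; rewrite E (negbTE (arc_irr multi y)).
Qed.

(** The complement of [H] has [alpha] or [alpha + 1] elements. *)
Lemma hamiltonian_off_arc (H : {set V}) :
    [disjoint H & [set x; y]] -> 2 * r <= #|H|.+1 -> #|H| <= 2 * r ->
  exists2 p, cycle e p & perm_eq p (enum H).
Proof.
move=> dis lo hi; have cH := cardsC H; rewrite card_V -rE in cH.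
by apply: (near_regular_hamiltonian reg alpha_gt1 c_ge7 rE) => //; clear -cH lo hi; lia.
Qed.

Lemma arc_in_triangle_lengths l : A :&: B != set0 -> 3 <= l <= 2 * r + 1 ->
  arc_in_cycle_of_length e x y l.
Proof.
rewrite -card_gt0 => AB0 /andP[l3 lr].
have cU := cardsUI A B; rewrite card_A card_B in cU.
have sUD : A :|: B \subset ~: [set x; y].
  by apply/subsetP=> v vAB; rewrite inE off_arc.
have cD : #|~: [set x; y]| = 2 * r + alpha - 2.
  have := cardsC [set x; y]; rewrite cards2 card_V -rE.
  have -> : x != y by apply/eqP=> E; move: xy; rewrite E (negbTE (arc_irr multi y)).
  by move=> <-; rewrite addKn.
have [|H [sUH sHD cH]] := subset_of_card (n := 2 * r - 1) sUD.
  by rewrite cD; clear -cU AB0 alpha_gt1; lia.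
have dis : [disjoint H & [set x; y]] by rewrite disjoints_subset.
have [||p Cp pe] := hamiltonian_off_arc dis; try by clear -cH; lia.
have pH v : v \in H -> v \in p by rewrite (perm_mem pe) mem_enum.
have Up : uniq p by rewrite (perm_uniq pe) enum_uniq.
have sA : A \subset H := subset_trans (subsetUl A B) sUH.
have sB : B \subset H := subset_trans (subsetUr A B) sUH.
have sz : size p < #|A| + #|B|.
  by rewrite (perm_size pe) -cardE cH card_A card_B; clear -r_ge alpha_gt1; lia.
have [a aA fa] := @hits_by_counting V p A B (l - 3) Up
  (fun v vA => pH v (subsetP sA v vA)) (fun v vB => pH v (subsetP sB v vB)) sz.
rewrite -(subnK l3); apply: (cycle_from_hamiltonian Cp pe dis _ aA _ fa).
  by rewrite cH; clear -lr l3; lia.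
exact: (subsetP sA).
Qed.

(** If no vertex of [A] is followed by one of [B] after [l - 3] steps, then [A] is
    mapped into itself, since [H] consists of vertices of [A] and [B] only. *)
Lemma disjoint_nbhds_lengths (H : {set V}) l :
    A :&: B = set0 -> A \subset H -> H \subset A :|: B ->
    2 * r <= #|H|.+1 -> 3 < l < #|H| + 3 ->
    ~~ (#|H| %/ gcdn (l - 3) #|H| %| r) ->
  arc_in_cycle_of_length e x y l.
Proof.
move=> AB0 sAH sHU lo /andP[l4 lH] ndiv.
have cU := cardsUI A B; rewrite AB0 cards0 addn0 card_A card_B in cU.
have hi : #|H| <= 2 * r.
  by move: (subset_leq_card sHU); rewrite cU; clear; lia.
have dis : [disjoint H & [set x; y]].
  by rewrite disjoints_subset; apply/subsetP=> v /(subsetP sHU) /off_arc; rewrite in_setC.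
have [p Cp pe] := hamiltonian_off_arc dis lo hi.
have pH v : v \in H -> v \in p by rewrite (perm_mem pe) mem_enum.
have Up : uniq p by rewrite (perm_uniq pe) enum_uniq.
have sp : size p = #|H| by rewrite (perm_size pe) -cardE.
have l3 : 3 <= l by apply: ltnW.
have sAp : {subset A <= p} by move=> v /(subsetP sAH) /pH.
have [/exists_inP[a aA fa]|/exists_inPn none] :=
    boolP [exists a in A, iter (l - 3) (next p) a \in B].
  rewrite -(subnK l3); apply: (cycle_from_hamiltonian Cp pe dis _ aA _ fa).
    by clear -lH l3; lia.
  exact: (subsetP sAH).
case/negP: ndiv; rewrite -sp -card_A; apply: rotation_invariant_card => //.
- by rewrite subn_gt0.
- by rewrite -size_eq0 sp; clear -lo r_ge alpha_gt1; lia.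
move=> a aA; have := none a aA.
have : iter (l - 3) (next p) a \in p by rewrite mem_iter_next sAp.
rewrite (perm_mem pe) mem_enum => /(subsetP sHU); rewrite in_setU.
by case/orP=> // ->.
Qed.

(** For all lengths but the last, one vertex of [B] is dropped: [r] and [2 * r - 1]
    are coprime, which excludes any proper period.  For the last length no vertex can
    be spared, but then the step [2 * r - 1] is coprime to [2 * r]. *)
Lemma arc_in_no_triangle_lengths l : A :&: B = set0 -> 4 <= l <= 2 * r + 2 ->
  arc_in_cycle_of_length e x y l.
Proof.
move=> AB0 /andP[l4 lr].
have cU := cardsUI A B; rewrite AB0 cards0 addn0 card_A card_B in cU.
have r0 : 0 < r by clear -r_ge alpha_gt1; lia.
have [l_max|l_lt] : l = 2 * r + 2 \/ l < 2 * r + 2 by clear -lr; lia.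
  apply: (disjoint_nbhds_lengths (H := A :|: B)) => //; rewrite ?subsetUl //.
  - by rewrite cU; clear; lia.
  - by rewrite cU l_max; clear -r0; lia.
  have -> : #|A :|: B| = (l - 3).+1 by rewrite cU l_max; clear -r0; lia.
  have /eqP -> : coprime (l - 3) (l - 3).+1 by apply: coprimenS.
  rewrite divn1; apply/negP=> /(dvdn_leq r0); rewrite l_max; clear -r0; lia.
have [b bB] : exists b, b \in B by apply/set0Pn; rewrite -card_gt0 card_B.
have bA : b \notin A.
  by apply/negP=> bA; have := in_set0 b; rewrite -AB0 inE bA bB.
have cH : #|(A :|: B) :\ b| = 2 * r - 1.
  by have := cardsD1 b (A :|: B); rewrite cU inE bB orbT; clear; lia.
apply: (disjoint_nbhds_lengths (H := (A :|: B) :\ b)) => //.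
- by rewrite subsetD1 subsetUl.
- exact: subsetDl.
- by rewrite cH; clear -r0; lia.
- by rewrite cH; clear -r0 l_lt l4; lia.
set m := #|_ :\ _|; set d := l - 3; apply/negP=> kr.
have gm : gcdn d m %| m by apply: dvdn_gcdr.
have km : m %/ gcdn d m %| m by apply: dvdn_div.
have : m %/ gcdn d m %| 1.
  have -> : 1 = 2 * r - m by rewrite /m cH; clear -r0; lia.
  by apply: dvdn_sub => //; apply: dvdn_mull.
rewrite dvdn1 => /eqP k1; have := divnK gm; rewrite k1 mul1n => gE.
have d0 : 0 < d by rewrite /d subn_gt0.
have : m <= d by rewrite -gE; apply: dvdn_leq => //; apply: dvdn_gcdl.
by rewrite /m cH /d; clear -l_lt l4 r0; lia.
Qed.

End ArcCycles.

Theorem theorem1p2 (c alpha r : nat) (V : finType) (P : {set {set V}})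
    (e : rel V)
    (c_ge7 : 7 <= c) (alpha_ge2 : 2 <= alpha)
    (tourn : multipartite_tournament c P e)
    (card_parts : forall A : {set V}, A \in P -> #|A| = alpha)
    (reg : regular_digraph e r) :
  forall x y : V, e x y ->
    [/\ arc_in_cycles_of_distinct_lengths e x y (c * alpha - alpha - 1),
        arc_in_cycle_of_length e x y 3 ->
          forall l : nat, 3 <= l <= c * alpha - alpha + 1 ->
            arc_in_cycle_of_length e x y l
      & ~ arc_in_cycle_of_length e x y 3 ->
          forall l : nat, 4 <= l <= c * alpha - alpha + 2 ->
            arc_in_cycle_of_length e x y l].
Proof.
move=> x y xy.
have [regm card_V] := tournament_regular_multipartite tourn card_parts reg.
have rE : c * alpha - alpha = 2 * r.
  by rewrite -(card_regular_multipartite x regm) in card_V; clear -card_V; lia.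
rewrite rE; have r_ge : 6 * alpha <= 2 * r.
  have : 7 * alpha <= c * alpha by rewrite leq_mul2r c_ge7 orbT.
  by rewrite -rE; clear; lia.
pose AB := [set a | e y a] :&: [set b | e b x].
have tri l : AB != set0 -> 3 <= l <= 2 * r + 1 -> arc_in_cycle_of_length e x y l.
  exact: (arc_in_triangle_lengths regm alpha_ge2 c_ge7 card_V xy).
have notri l : AB = set0 -> 4 <= l <= 2 * r + 2 -> arc_in_cycle_of_length e x y l.
  exact: (arc_in_no_triangle_lengths regm alpha_ge2 c_ge7 card_V xy).
have [AB0|AB1] := eqVneq AB set0; split.
- apply: (@distinct_lengths _ _ _ _ 4) => l lb; apply: notri => //.
  by clear -lb alpha_ge2 r_ge; lia.
- case/triangle_through_arc=> z yz zx; have := in_set0 z.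
  by rewrite -AB0 !inE yz zx.
- by move=> _ l; apply: notri.
- apply: (@distinct_lengths _ _ _ _ 3) => l lb; apply: tri => //.
  by clear -lb alpha_ge2 r_ge; lia.
- by move=> _ l; apply: tri.
by case; apply: tri => //; clear -alpha_ge2 r_ge; lia.
Qed.
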